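(* Assume that there is $p>2$ such that $\tau_p=\mathbb{E}[|\varepsilon_i|^p]<\infty$ for all $i$, and let $q>0$ be such that $2(q+1)<p$. Let $\theta>0$ and let $\{L_m,\ m\in\mathcal{M}\}$ be a collection of positive weights. If the penalty function $\mathrm{pen}:\mathcal{M}\to\mathbb{R}_+$ satisfies $$\mathrm{pen}(m)\ge(1+\theta+L_m)\frac{\mathrm{Tr}({}^tP_n\pi_mP_n)}{n}\sigma^2\quad\text{for all }m\in\mathcal{M},$$ then the penalized least-squares estimator $\tilde s=\hat s_{\hat m}$ satisfies $$\mathbb{E}\left[\|s-\tilde s\|_n^{2q}\right]^{1/q}\le C\inf_{m\in\mathcal{M}}\left\{\|s-s_m\|_n^2+\mathrm{pen}(m)\right\}+\frac{\rho^2(P_n)\sigma^2}{n}R_n(p,q,\theta)^{1/q},$$ where $$R_n(p,q,\theta)=C'\tau_p\left[N_0+\sum_{m\in\mathcal{M}:S_m\ne\{0\}}\left(1+\frac{\mathrm{Tr}({}^tP_n\pi_mP_n)}{\rho^2(\pi_mP_n)}\right)\left(\frac{L_m\mathrm{Tr}({}^tP_n\pi_mP_n)}{\rho^2(P_n)}\right)^{q-p/2}\right]$$ and $C=C(q,\theta)$, $C'=C'(p,q,\theta)$ are positive constants depending only on the indicated quantities.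
   Context: For $x,y\in\mathbb{R}^n$: $\|x\|_n^2=\frac1n\sum_{i=1}^nx_i^2$ and $\langle x,y\rangle_n=\frac1n\sum_{i=1}^nx_iy_i$. For a real $n\times n$ matrix $A$, $\rho(A)=\sup_{x\ne0}\|Ax\|_n/\|x\|_n$ is the spectral norm, and ${}^tA$ is the transpose. One observes $Y=s+\sigma P_n\varepsilon\in\mathbb{R}^n$, where $P_n$ is a known real $n\times n$ matrix (not necessarily invertible), $s\in\mathrm{Im}(P_n)$ is unknown and deterministic, $\sigma>0$ is known, and $\varepsilon=(\varepsilon_1,\dots,\varepsilon_n)'$ is a random vector with i.i.d. centered components of unit variance. $\{S_m,\ m\in\mathcal{M}\}$ is a finite or countable collection of linear subspaces of $\mathrm{Im}(P_n)$; $\pi_m$ is the orthogonal projection onto $S_m$; $s_m=\pi_ms$; $\hat s_m=\pi_mY$. $N_0$ is the number of $m\in\mathcal{M}$ with $\dim(S_m)=0$. Given a penalty function $\mathrm{pen}$, $\hat m$ is any minimizer over $m\in\mathcal{M}$ of $\|Y-\hat s_m\|_n^2+\mathrm{pen}(m)$, and $\tilde s=\hat s_{\hat m}$. *)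

(* Defs.v *)
From HB Require Import structures.
From mathcomp Require Import all_boot all_order all_algebra.
From mathcomp Require Import all_classical all_reals all_analysis.

Set Implicit Arguments.
Unset Strict Implicit.
Unset Printing Implicit Defensive.

Import Order.TTheory GRing.Theory Num.Theory.

Local Open Scope classical_set_scope.
Local Open Scope ring_scope.

Section euclidean.
Context {R : realType} {n : nat}.
Implicit Types (x y : 'cV[R]_n) (A B : 'M[R]_n) (U : {vspace 'cV[R]_n}).

Definition inner_n x y : R := n%:R^-1 * \sum_(i < n) x i 0 * y i 0.

Definition norm_n x : R := Num.sqrt (n%:R^-1 * \sum_(i < n) x i 0 ^+ 2).

(* The supremum is a real one: the set is bounded, and nonempty once 0 < n. *)
Definition spectral_norm A : R :=
  sup [set norm_n (A *m x) / norm_n x | x in [set x | x != 0]].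

Definition image_mx A : {vspace 'cV[R]_n} := limg (linfun (mulmx A)).

Definition is_orthoproj U A : Prop :=
  forall x, A *m x \in U /\ (forall u, u \in U -> inner_n (x - A *m x) u = 0).

(* [xget] picks a matrix satisfying [is_orthoproj U]; [orthoprojP] shows that
   there is one, and [is_orthoproj_inj] that it is unique (for 0 < n). *)
Definition orthoproj U : 'M[R]_n := xget 0 [set A | is_orthoproj U A].

Lemma mem_image_mxP A x : x \in image_mx A <-> exists z, x = A *m z.
Proof.
split=> [/memv_imgP[z _ ->]|[z ->]]; first by exists z; rewrite lfunE.
by apply/memv_imgP; exists z; rewrite ?memvf// lfunE.
Qed.

Lemma inner_nE x y : inner_n x y = n%:R^-1 * (x^T *m y) 0 0.
Proof. by rewrite /inner_n mxE; congr *%R; apply: eq_bigr => i _; rewrite mxE. Qed.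

Lemma dot_eq0 m (x : 'cV[R]_m) : (x^T *m x) 0 0 = 0 -> x = 0.
Proof.
rewrite mxE => /eqP; rewrite psumr_eq0 => [/allP h|i _]; last first.
  by rewrite mxE -expr2 sqr_ge0.
apply/colP => i; have := h i (mem_index_enum i).
by rewrite !mxE -expr2 sqrf_eq0 => /eqP.
Qed.

Lemma orthoproj_exists U : exists A, is_orthoproj U A.
Proof.
pose B : 'M[R]_(n, \dim U) := \matrix_(i, j) (vbasis U)`_j i 0.
have BE (c : 'cV_(\dim U)) : B *m c = \sum_j c j 0 *: (vbasis U)`_j.
  apply/colP => i; rewrite mxE summxE; apply: eq_bigr => j _.
  by rewrite !mxE mulrC.
have BU (c : 'cV_(\dim U)) : B *m c \in U.
  rewrite BE; apply: memv_suml => j _; apply: memvZ.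
  by apply: vbasis_mem; rewrite mem_nth// size_tuple.
have UB u : u \in U -> exists c, u = B *m c.
  move=> uU; exists (\col_j coord (vbasis U) j u).
  rewrite BE [LHS](coord_vbasis uU); apply: eq_bigr => j _.
  by rewrite mxE.
have Binj (c : 'cV_(\dim U)) : B *m c = 0 -> c = 0.
  rewrite BE => h; apply/colP => j; rewrite mxE.
  have /freeP := basis_free (vbasisP U).
  by move=> /(_ (fun j => c j 0) h j).
have GU : B^T *m B \in unitmx.
  rewrite -row_free_unit -kermx_eq0; apply/eqP/row_matrixP => i.
  rewrite row0; set v := row i _.
  have /(congr1 (mulmx^~ v^T)) : v *m (B^T *m B) = 0.
    by apply/sub_kermxP; exact: row_sub.
  rewrite mul0mx mulmxA -mulmxA => h.
  apply: trmx_inj; rewrite trmx0; apply: Binj; apply: dot_eq0.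
  by rewrite trmx_mul trmxK h mxE.
exists (B *m invmx (B^T *m B) *m B^T) => x; split; first by rewrite -!mulmxA.
move=> _ /UB[c ->]; rewrite inner_nE mulmxA.
rewrite -(trmxK B) -trmx_mul trmxK mulmxBr !mulmxA mulmxV// mul1mx subrr.
by rewrite trmx0 mul0mx mxE mulr0.
Qed.

Lemma orthoprojP U : is_orthoproj U (orthoproj U).
Proof. by have [A hA] := orthoproj_exists U; exact: (xgetPex 0 (ex_intro _ A hA)). Qed.

Lemma is_orthoproj_inj U A B :
  (0 < n)%N -> is_orthoproj U A -> is_orthoproj U B -> A = B.
Proof.
move=> n0 hA hB; have AB x : A *m x = B *m x.
  have [AU Ax] := hA x; have [BU Bx] := hB x.
  have dU : A *m x - B *m x \in U by rewrite rpredB.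
  have := Bx _ dU; have := Ax _ dU; rewrite !inner_nE => /eqP a /eqP b.
  have n0' : n%:R^-1 != 0 :> R by rewrite invr_eq0 pnatr_eq0 -lt0n.
  move: a b; rewrite !mulf_eq0 (negbTE n0')/= => /eqP a /eqP b.
  apply/eqP; rewrite -subr_eq0; apply/eqP; apply: dot_eq0.
  have -> : (A *m x - B *m x)^T = (x - B *m x)^T - (x - A *m x)^T.
    by rewrite -linearB/= opprB [in RHS]addrC addrA subrK.
  by rewrite mulmxBl mxE [in X in _ + X]mxE a b subrr.
apply/matrixP => i j; have := AB (delta_mx j 0).
by rewrite -!colE => /colP/(_ i); rewrite !mxE.
Qed.

End euclidean.

Section iid.
Context d (T : measurableType d) (R : realType) (Pr : probability T R).
Context (I : finType) (X : I -> {RV Pr >-> R}).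

Definition mutually_independent : Prop :=
  forall (J : {set I}) (A : I -> set R), (forall i, measurable (A i)) ->
    Pr (\bigcap_(i in [set` J]) (X i @^-1` A i)) =
    (\prod_(i in J) Pr (X i @^-1` A i))%E.

Definition identically_distributed : Prop :=
  forall (i j : I) (A : set R), measurable A ->
    distribution Pr (X i) A = distribution Pr (X j) A.

Definition iid : Prop := mutually_independent /\ identically_distributed.

End iid.

Section model_selection.
Context {R : realType} {n : nat} {M : countType}.
Variables (P : 'M[R]_n) (S : M -> {vspace 'cV[R]_n}).

Definition least_squares (Y : 'cV[R]_n) (m : M) : 'cV[R]_n :=
  orthoproj (S m) *m Y.

Definition penalized_criterion (pen : M -> R) (Y : 'cV[R]_n) (m : M) : R :=
  norm_n (Y - least_squares Y m) ^+ 2 + pen m.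

Definition model_trace (m : M) : R := \tr (P^T *m orthoproj (S m) *m P).

(* [N0] and the series may be infinite. *)
Definition N0 : \bar R := counting [set m | \dim (S m) = 0%N].

Definition remainder (C' tau p q : R) (L : M -> R) : \bar R :=
  (C'%:E * tau%:E *
   (N0 + \esum_(m in [set m | S m != 0%VS])
     ((1 + model_trace m / spectral_norm (orthoproj (S m) *m P) ^+ 2) *
      (L m * model_trace m / spectral_norm P ^+ 2) `^ (q - p / 2))%:E))%E.

End model_selection.

(* Main.v *)
Require Import Defs.
From HB Require Import structures.
From mathcomp Require Import all_boot all_order all_algebra.
From mathcomp Require Import all_classical all_reals all_analysis.
From mathcomp Require Import measurable_realfun ring lra.

Set Implicit Arguments.
Unset Strict Implicit.
Unset Printing Implicit Defensive.

Import Order.TTheory GRing.Theory Num.Theory.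

Local Open Scope classical_set_scope.
Local Open Scope ring_scope.

(* Write e = sigma P eps for the noise and a_m = ||s - s_m||^2 + pen(m).
   Comparing the criterion at mhat and at m bounds ||s - stilde||^2 by a multiple
   of a_m plus deviations, at mhat and at m, of two kinds: those of the quadratic
   form ||pi_m e||^2 above (1 + theta + L_m / 2) times its mean, and those of
   <u_m, e>^2 above a fraction of L_m times that mean, u_m being the (non-random)
   unit vector along s - s_m.  The deviation at mhat is at most the sum over all
   models, so everything reduces to moment bounds for one model at a time; a
   q-th moment above level b is traded for a (p/2)-th moment at the price
   b^(q - p/2).

   The moment bound needed is
     E (|W| - c)_+^p <= C tau_p r^(p/2) (1 + t / r),   W = sum_i eps_i b_i,
   where t = sum_i |b_i|^2, c^2 >= (1 + theta) t and r bounds the operator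
   sum_i b_i b_i^T.  It comes from a leave-one-out argument.  With
   psi(x) = (x - c)_+^p / x^2 and W_i = W - eps_i b_i,
     (|W| - c)_+^p = |W|^2 psi(|W|) = sum_i eps_i <b_i, W> psi(|W|),
   and eps_i <b_i, W_i> psi(|W_i|) has mean zero because W_i is independent of
   eps_i.  Expanding psi(|W|) around |W_i| leaves a term close to t psi(|W|),
   which is at most (|W| - c)_+^p / (1 + theta) and is absorbed by the left-hand
   side, a term bounded by r (|W| - c)_+^(p-2), absorbed by Young's inequality
   up to r^(p/2), and remainders of the order of |eps_i b_i|^p. *)

(** * Leave-one-out independence *)

(** The constants must not depend on the dimension: sizes enter the moment bound only through [t],
    [r] and sums of |b_i|^p, and powers of [n] are tolerated only to prove integrability. The square
    in the denominator of psi is what starts the argument: x^2 psi(x) contains exactly two factors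
    W, one opened linearly in the [eps_i], the other paired with b_i. Two demands then conflict.
    Factoring out E eps_i^2 = 1 needs coefficients that ignore eps_i, hence evaluated at W_i; the
    absorption and the operator bound, which sums <b_i, v>^2 over i for a single v, need the common
    vector W. So the increment is first estimated at W_i and then carried back to W. Both passages
    distinguish whether |eps_i b_i| is small against the excess (Taylor-like bounds, with a small
    loss in the leading factor) or not (everything is of order of a power of |eps_i b_i|). The
    strict gap between c^2 and t pays for all these losses. *)

Section leave_one_out_independence.
Context d (T : measurableType d) (R : realType) (Pr : probability T R).
Context (I : finType) (X : I -> {RV Pr >-> R}) (i0 : I).

(** A pi-system for the events that do not see [X i0]. The family [A] is total on [I] with its value
    at [i0] ignored, so it can be completed there by any set. *)
Definition cylinders : set (set T) :=
  [set \bigcap_(j in [set` [set~ i0]%SET]) X j @^-1` A j |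
     A in [set A : I -> set R | forall j, measurable (A j)]].

(** [T] itself with a coarser sigma-algebra: measurability from [other_coords] expresses dependence
    on the remaining variables alone, without passing to a product space. *)
Let other_coords := g_sigma_algebraType cylinders.

Lemma cylinders_measurable : cylinders `<=` measurable.
Proof.
move=> _ [A mA <-]; apply: fin_bigcap_measurable => // j _.
by rewrite -[_ @^-1` _]setTI; exact: measurable_funPT.
Qed.

Lemma cylinders_setI : setI_closed cylinders.
Proof.
move=> _ _ [A mA <-] [B mB <-]; exists (fun j => A j `&` B j).
  by move=> j; exact: measurableI.
by rewrite -bigcapI; apply: eq_bigcapr => j _; rewrite preimage_setI.
Qed.

Lemma cylinders_setT : cylinders setT.
Proof.
exists (fun=> setT) => //.
by rewrite -subTset => w _ j _.
Qed.

Lemma generated_measurable A : (<<s cylinders >>) A -> measurable A.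
Proof.
apply: smallest_sub; first exact: sigma_algebra_measurable.
exact: cylinders_measurable.
Qed.

Lemma measurable_fun_other_coords (f : T -> R) :
  measurable_fun (setT : set other_coords) (f : other_coords -> R) ->
  measurable_fun setT f.
Proof.
move=> mf _ B mB; have := mf measurableT B mB; rewrite !setTI.
exact: generated_measurable.
Qed.

Lemma measurable_other_coord j :
  j != i0 -> measurable_fun (setT : set other_coords) (X j : other_coords -> R).
Proof.
move=> ji0 _ B mB; rewrite setTI; apply: sub_sigma_algebra.
exists (fun k => if k == j then B else setT) => [k|].
  by case: ifP.
apply/seteqP; split => [w /(_ j)|w Bw k] /=.
  by rewrite eqxx; apply; rewrite /= !inE.
by move=> _; case: ifPn => // /eqP ->.
Qed.

Hypothesis indep : mutually_independent X.

(** Independence is used twice for one family, [A'] completed by [B] at [i0]: over all indices and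
    over all but [i0]. The two products differ by the factor at [i0]. *)
Lemma cylinder_independent A B : measurable B -> cylinders A ->
  Pr (A `&` X i0 @^-1` B) = (Pr (X i0 @^-1` B) * Pr A)%E.
Proof.
move=> mB [A' mA' <-{A}].
pose F j := if j == i0 then B else A' j.
have mF j : measurable (F j) by rewrite /F; case: ifP.
have := indep [set: I]%SET mF.
rewrite (bigD1 i0) ?inE//= {2}/F eqxx => E1.
have := indep [set~ i0]%SET mF.
have FA : \bigcap_(i in [set` [set~ i0]%SET]) X i @^-1` F i =
          \bigcap_(i in [set` [set~ i0]%SET]) X i @^-1` A' i.
  by apply: eq_bigcapr => j /=; rewrite !inE /F => /negbTE ->.
rewrite FA => ->.
rewrite [X in (_ * X)%E](_ : _ =
    \prod_(i in [set: I]%SET | i != i0) Pr (X i @^-1` F i))%E; last first.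
  by apply: eq_bigl => j; rewrite !inE.
rewrite -E1; congr (Pr _); apply/seteqP; split => [w [h Bw] j _|w h].
  rewrite /F /=; case: ifPn => [/eqP -> //|ji].
  by apply: h; rewrite /= !inE.
split; last by have := h i0; rewrite /= /F eqxx inE; exact.
move=> j /=; rewrite !inE => /negbTE ji.
by have := h j; rewrite /= /F ji inE; exact.
Qed.

(** Uniqueness of measures: as functions of [A], both sides are finite measures that agree on the
    pi-system [cylinders]. *)
Lemma generated_independent A B : measurable B -> (<<s cylinders >>) A ->
  Pr (A `&` X i0 @^-1` B) = (Pr (X i0 @^-1` B) * Pr A)%E.
Proof.
move=> mB sA.
have mXB : measurable (X i0 @^-1` B).
  by rewrite -[_ @^-1` _]setTI; exact: measurable_funPT.
have c0 : 0 <= fine (Pr (X i0 @^-1` B)) by exact: fine_ge0.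
pose m1 : {measure set T -> \bar R} := mrestr Pr mXB.
pose m2 : {measure set T -> \bar R} := mscale (NngNum c0) Pr.
have cE : (fine (Pr (X i0 @^-1` B)))%:E = Pr (X i0 @^-1` B).
  by rewrite fineK// fin_num_measure.
have -> : (Pr (X i0 @^-1` B) * Pr A)%E = m2 A by rewrite /m2/= /mscale/= cE.
rewrite -[LHS]/(m1 A).
apply: (@g_sigma_algebra_measure_unique _ R T cylinders _ (fun=> setT)) => //.
- exact: cylinders_measurable.
- by move=> _; exact: cylinders_setT.
- by rewrite -subTset => w _; exists 0%N.
- exact: cylinders_setI.
- move=> C cC; rewrite /m1 /m2 /= /mrestr /mscale /= cE.
  exact: cylinder_independent.
- move=> _; rewrite /m1 /= /mrestr setTI.
  by rewrite (le_lt_trans (probability_le1 _ _))// ltry.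
Qed.

Let forget : T -> other_coords := id.

Let measurable_forget : measurable_fun setT forget.
Proof. by move=> _ B sB; rewrite setTI; exact: generated_measurable. Qed.

HB.instance Definition _ := isMeasurableFun.Build _ _ _ _ forget
  measurable_forget.

Let split_coord : T -> R * other_coords := fun w => (X i0 w, forget w).

Let measurable_split_coord : measurable_fun setT split_coord.
Proof. exact: measurable_fun_pair. Qed.

HB.instance Definition _ := isMeasurableFun.Build _ _ _ _ split_coord
  measurable_split_coord.

(** The joint law of [X i0] and the identity into [other_coords] agrees with the product of the
    marginals on rectangles, hence everywhere, and Tonelli factors the integral. Nonnegativity
    replaces integrability, so infinite values are allowed. *)
Lemma integral_independent (f : R -> R) (g : T -> R) :
  measurable_fun setT f -> (forall x, 0 <= f x) ->
  measurable_fun (setT : set other_coords) (g : other_coords -> R) ->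
  (forall w, 0 <= g w) ->
  (\int[Pr]_w (f (X i0 w) * g w)%:E =
   \int[Pr]_w (f (X i0 w))%:E * \int[Pr]_w (g w)%:E)%E.
Proof.
move=> mf f0 mg g0.
pose m1 := distribution Pr (X i0).
pose m2 : probability other_coords R := distribution Pr forget.
pose m' := distribution Pr split_coord.
have m'E : forall C, measurable C -> (m1 \x m2)%E C = m' C.
  apply: product_measure_unique => A B mA mB.
  rewrite /m' /m1 /m2 /distribution /pushforward/=.
  rewrite -generated_independent//; congr (Pr _).
  by apply/seteqP; split => w /= [].
have mfg : measurable_fun setT
    (EFin \o (fun z : R * other_coords => f z.1 * g z.2)).
  apply/measurable_EFinP; apply: measurable_funM.
    exact: measurableT_comp.
  exact: (measurableT_comp mg).
transitivity (\int[m']_z (f z.1 * g z.2)%:E)%E.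
  by rewrite ge0_integral_distribution// => z; rewrite lee_fin mulr_ge0.
rewrite (eq_measure_integral (m1 \x m2)%E)/=; last first.
  by move=> A mA _; rewrite m'E.
rewrite fubini_tonelli1//=; last by move=> z; rewrite lee_fin mulr_ge0.
transitivity (\int[m1]_x ((f x)%:E * \int[m2]_y (g y)%:E))%E.
  apply: eq_integral => x _; rewrite /fubini_F/=.
  under eq_integral do rewrite EFinM.
  rewrite ge0_integralZl//.
  - exact/measurable_EFinP.
  - by move=> y _; rewrite lee_fin.
  - by rewrite lee_fin.
rewrite ge0_integralZr//.
- congr (_ * _)%E.
    by rewrite ge0_integral_distribution//; exact/measurable_EFinP.
  rewrite ge0_integral_distribution//; exact/measurable_EFinP.
- exact/measurable_EFinP.
- by move=> y _; rewrite lee_fin.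
- by apply: integral_ge0 => y _; rewrite lee_fin.
Qed.

End leave_one_out_independence.

(** * The excess over a level and its weight *)

Section excess.
Context {R : realType}.
Implicit Types (c x y h a p eta : R).

Lemma powR_sub2 x p : 2 < p -> 0 <= x -> x `^ p = x `^ (p - 2) * x ^+ 2.
Proof.
move=> p2 x0; rewrite -powR_mulrn// -powRD ?subrK//.
by apply/implyP => /eqP; lra.
Qed.

Lemma powR_sub1 x p : 1 < p -> 0 <= x -> x `^ p = x `^ (p - 1) * x.
Proof. by move=> p1 x0; rewrite mulrC mulr_powRB1//; lra. Qed.

Lemma powR_le1D x p p' : 0 <= x -> 0 <= p -> p <= p' -> x `^ p <= 1 + x `^ p'.
Proof.
move=> x0 p0 pp'; have [x1|x1] := leP x 1.
  rewrite ler_wpDr ?powR_ge0//.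
  apply: (@le_trans _ _ (1 `^ p)); last by rewrite powR1.
  by rewrite ge0_ler_powR ?nnegrE.
by rewrite ler_wpDl// ler_powR// ltW.
Qed.

Definition excess c x := Num.max (x - c) 0.

(* At [x = 0] division by zero gives 0, consistently with the vanishing of the
   weight on [x <= c]. *)
Definition excess_weight p c x := excess c x `^ p / x ^+ 2.

Lemma excess_ge0 c x : 0 <= excess c x.
Proof. by rewrite /excess le_max lexx orbT. Qed.

Lemma excess_le c x : 0 <= c -> 0 <= x -> excess c x <= x.
Proof. by rewrite /excess ge_max => c0 x0; apply/andP; split; lra. Qed.

Lemma ler_excess c x y : x <= y -> excess c x <= excess c y.
Proof. by move=> xy; rewrite /excess le_max2// lerB. Qed.

Lemma excess_eq0 c x : x <= c -> excess c x = 0.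
Proof. by move=> xc; apply/max_idPr; lra. Qed.

Lemma excessE c x : c <= x -> excess c x = x - c.
Proof. by move=> xc; apply/max_idPl; lra. Qed.

Lemma excess_lipschitz c x y h : 0 <= h -> y <= x + h ->
  excess c y <= excess c x + h.
Proof.
move=> h0 yxh; rewrite {1}/excess ge_max; apply/andP; split.
  have : x - c <= excess c x by rewrite /excess le_max lexx.
  lra.
by rewrite addr_ge0// excess_ge0.
Qed.

Lemma excess_weight_ge0 p c x : 0 <= excess_weight p c x.
Proof. by rewrite divr_ge0// ?powR_ge0// sqr_ge0. Qed.

Lemma excess_weight_eq0 p c x : 0 < p -> x <= c -> excess_weight p c x = 0.
Proof.
by move=> p0 xc; rewrite /excess_weight excess_eq0// powR0 ?mul0r// gt_eqF.
Qed.

Lemma mul_excess_weight p c x : 0 < p -> 0 < c -> 0 <= x ->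
  x ^+ 2 * excess_weight p c x = excess c x `^ p.
Proof.
move=> p0 c0 x0; have [xc|cx] := leP x c.
  by rewrite excess_weight_eq0// excess_eq0// powR0 ?mulr0// gt_eqF.
rewrite /excess_weight mulrC divfK// sqrf_eq0 gt_eqF//; lra.
Qed.

Lemma excess_weight_le_powR p c x : 2 < p -> 0 < c -> 0 <= x ->
  excess_weight p c x <= excess c x `^ (p - 2).
Proof.
move=> p2 c0 x0; have [xc|cx] := leP x c.
  by rewrite excess_weight_eq0// ?powR_ge0//; lra.
have x0' : 0 < x by lra.
rewrite /excess_weight powR_sub2 ?excess_ge0//.
rewrite ler_pdivrMr ?exprn_gt0// ler_wpM2l ?powR_ge0//.
by rewrite lerXn2r ?nnegrE ?excess_ge0//; apply: excess_le => //; lra.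
Qed.

(** Above [c] the weight is (x - c)^(p-2) times the square of (x - c) / x, and both factors
    increase. *)
Lemma ler_excess_weight p c x y : 2 < p -> 0 < c -> x <= y ->
  excess_weight p c x <= excess_weight p c y.
Proof.
move=> p2 c0 xy; have [xc|cx] := leP x c.
  by rewrite excess_weight_eq0 ?excess_weight_ge0//; lra.
have x0 : 0 < x by lra.
have y0 : 0 < y by lra.
have wE z : excess_weight p c z = excess c z `^ (p - 2) * (excess c z / z) ^+ 2.
  by rewrite /excess_weight powR_sub2 ?excess_ge0// -mulrA expr_div_n.
have ez z : 0 < z -> 0 <= excess c z / z.
  by move=> z0; rewrite divr_ge0 ?excess_ge0// ltW.
rewrite !wE ler_pM ?powR_ge0 ?sqr_ge0//.
  by rewrite ge0_ler_powR ?nnegrE ?excess_ge0// ?ler_excess//; lra.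
rewrite lerXn2r ?nnegrE ?ez// !excessE; [|lra|lra].
rewrite ler_pdivrMr// mulrAC ler_pdivlMr//; nra.
Qed.

(** If [h] is at most [e] times the excess at [x], the excess grows by a factor at most 1 + e;
    otherwise the excess at [y] is at most (1 + 1/e) h and the weight is of order h^(p-2). *)
Lemma excess_weight_growth p eta : 2 < p -> 0 < eta ->
  exists2 C, 0 < C & forall c x y h, 0 < c -> 0 <= x -> 0 <= h -> 0 <= y ->
    y <= x + h ->
    excess_weight p c y <= (1 + eta) * excess_weight p c x + C * h `^ (p - 2).
Proof.
move=> p2 eta0.
(* Chosen so that (1 + e)^p is exactly 1 + eta. *)
pose e := (1 + eta) `^ p^-1 - 1.
have e1 : (1 + e) `^ p = 1 + eta.
  rewrite /e addrC subrK -powRrM mulVf ?powRr1//; [lra|].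
  by rewrite gt_eqF//; lra.
have e0 : 0 < e.
  have := @gt0_ltr_powR R p^-1; rewrite invr_gt0 => /(_ _ 1 (1 + eta)).
  by rewrite !nnegrE powR1/e; lra.
exists ((1 + e^-1) `^ (p - 2)).
  by apply: powR_gt0; rewrite addr_gt0 ?invr_gt0.
move=> c x y h c0 x0 h0 y0 yxh.
have C0 : 0 <= (1 + e^-1) `^ (p - 2) * h `^ (p - 2).
  by rewrite mulr_ge0 ?powR_ge0.
have w0 := excess_weight_ge0 p c.
have [yx|xy] := leP y x.
  have := ler_excess_weight p2 c0 yx; have := w0 x; have := w0 y; nra.
have [hx|xh] := leP h (e * excess c x).
  rewrite ler_wpDr//.
  have [xc|cx] := leP x c.
    have h00 : h = 0.
      by apply/eqP; rewrite eq_le h0 andbT; move: hx; rewrite excess_eq0// mulr0.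
    by exfalso; lra.
  have x0' : 0 < x by lra.
  rewrite /excess_weight mulrA ler_pM ?powR_ge0 ?invr_ge0 ?sqr_ge0//; last first.
    rewrite lef_pV2 ?posrE ?exprn_gt0//; last lra.
    by rewrite lerXn2r ?nnegrE// ltW.
  rewrite -e1 -powRM ?excess_ge0//; last lra.
  rewrite ge0_ler_powR ?nnegrE ?excess_ge0//; first lra.
    by rewrite mulr_ge0 ?excess_ge0//; lra.
  by apply: (le_trans (excess_lipschitz c h0 yxh)); lra.
apply: (@le_trans _ _ ((1 + e^-1) `^ (p - 2) * h `^ (p - 2))); last first.
  by rewrite lerDr; apply: mulr_ge0; [lra|exact: w0].
apply: (le_trans (excess_weight_le_powR p2 c0 y0)).
have e'0 : 0 < e^-1 by rewrite invr_gt0.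
have k0 : 0 <= 1 + e^-1 by lra.
rewrite -powRM//.
rewrite ge0_ler_powR ?nnegrE ?excess_ge0//; first lra.
  exact: mulr_ge0.
apply: (le_trans (excess_lipschitz c h0 yxh)).
rewrite mulrDl mul1r addrC lerD2l mulrC ler_pdivlMr//; lra.
Qed.

(** Young's inequality for [x] and y^(p-1), with exponents p and p / (p - 1), gives this tangent
    bound without derivatives. *)
Lemma powR_convex_diff p x y : 1 < p -> 0 <= x -> x <= y ->
  y `^ p - x `^ p <= p * y `^ (p - 1) * (y - x).
Proof.
move=> p1 x0 xy; have y0 : 0 <= y by lra.
have p0 : 0 < p by lra.
have q0 : 0 < p / (p - 1) by rewrite divr_gt0//; lra.
have := @conjugate_powR _ x (y `^ (p - 1)) p (p / (p - 1)) x0 (powR_ge0 _ _) p0 q0.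
rewrite -powRrM mulrCA divff ?mulr1; last by rewrite gt_eqF//; lra.
have -> : p^-1 + (p / (p - 1))^-1 = 1.
  by rewrite invf_div; field; rewrite gt_eqF.
move=> /(_ erefl); rewrite invf_div.
rewrite (powR_sub1 p1 y0); set z := y `^ (p - 1); set xp := x `^ p => h.
have : p * (x * z) <= p * (xp / p + z * y * ((p - 1) / p)) by rewrite ler_wpM2l// ltW.
have -> : p * (xp / p + z * y * ((p - 1) / p)) = xp + z * y * (p - 1).
  by field; rewrite gt_eqF.
nra.
Qed.

(** A mean value bound written with squares, because squared norms expand exactly in each
    coordinate. Replacing 1/x^2 by 1/y^2 only increases the difference; then one factor of excess at
    [y] is at most y + x, which completes y - x into y^2 - x^2. *)
Lemma excess_weight_diff p c x y : 2 < p -> 0 < c -> 0 <= x -> x <= y ->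
  excess_weight p c y - excess_weight p c x <=
  p * excess c y `^ (p - 2) / y ^+ 2 * (y ^+ 2 - x ^+ 2).
Proof.
move=> p2 c0 x0 xy; have [yc|cy] := leP y c.
  rewrite !excess_weight_eq0 ?subr0//; try lra.
  apply: mulr_ge0; last by rewrite subr_ge0 lerXn2r ?nnegrE//; lra.
  apply: divr_ge0; last exact: sqr_ge0.
  by apply: mulr_ge0; [lra|exact: powR_ge0].
have y0 : 0 < y by lra.
have Y0 : 0 < y ^+ 2 by rewrite exprn_gt0.
have -> : excess_weight p c y = excess c y `^ p / y ^+ 2 by [].
have : excess c x `^ p / y ^+ 2 <= excess_weight p c x.
  have [xc|cx] := leP x c.
    by rewrite excess_eq0// powR0 ?mul0r ?excess_weight_ge0// gt_eqF//; lra.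
  rewrite ler_wpM2l ?powR_ge0// lef_pV2 ?posrE ?exprn_gt0//; last lra.
  by rewrite lerXn2r ?nnegrE//; lra.
suff : excess c y `^ p / y ^+ 2 - excess c x `^ p / y ^+ 2 <=
    p * excess c y `^ (p - 2) / y ^+ 2 * (y ^+ 2 - x ^+ 2) by lra.
rewrite -mulrBl [leRHS]mulrAC ler_wpM2r ?invr_ge0 ?sqr_ge0//.
have p1 : 1 < p by lra.
apply: (le_trans (powR_convex_diff p1 (excess_ge0 c x) (ler_excess c xy))).
rewrite (@powR_sub1 _ (p - 1)) ?excess_ge0//; last lra.
have -> : p - 1 - 1 = p - 2 by lra.
have k0 : 0 <= p * excess c y `^ (p - 2) by rewrite mulr_ge0 ?powR_ge0//; lra.
rewrite (mulrA p) -mulrA ler_wpM2l// subr_sqr mulrC.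
have d0 : 0 <= y - x by lra.
rewrite ler_pM ?excess_ge0 ?subr_ge0 ?ler_excess//.
  have := excess_lipschitz c d0 (_ : y <= x + (y - x)); rewrite addrC subrK.
  by move=> /(_ (lexx _)); lra.
by have := excess_le (ltW c0) (ltW y0); lra.
Qed.
End excess.

(** * Effect of a single coordinate on the weight: scalar inequalities *)

Section leave_one_out_increments.
Context {R : realType}.
Implicit Types (c x y h a l m p eta : R).

Lemma ex_small K eta : 0 < K -> 0 < eta ->
  exists d : R, [/\ 0 < d, d <= 2^-1 & K * d ^+ 2 <= eta].
Proof.
move=> K0 eta0; pose d := Num.min 2^-1 (eta / K).
have d0 : 0 < d by rewrite lt_min divr_gt0// andbT; lra.
have d1 : d <= 2^-1 by rewrite ge_min lexx.
have d2 : d <= eta / K by rewrite ge_min lexx orbT.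
have : K * d <= eta by move: d2; rewrite ler_pdivlMr// mulrC.
by exists d; split => //; nra.
Qed.

Lemma mul_excess_weight_le p c x : 2 < p -> 0 < c -> 0 <= x ->
  x * excess_weight p c x <= excess c x `^ (p - 1).
Proof.
move=> p2 c0 x0; have [xc|cx] := leP x c.
  by rewrite excess_weight_eq0 ?mulr0 ?powR_ge0//; lra.
have x0' : 0 < x by lra.
rewrite /excess_weight powR_sub1 ?excess_ge0//; last lra.
have -> : x * (excess c x `^ (p - 1) * excess c x / x ^+ 2) =
  excess c x `^ (p - 1) * (excess c x / x) by field; rewrite gt_eqF.
rewrite -[leRHS]mulr1 ler_wpM2l ?powR_ge0// ler_pdivrMr// mul1r.
by apply: excess_le => //; lra.
Qed.

Lemma excess_weight_dist p c x y : 2 < p -> 0 < c -> 0 <= x -> 0 <= y ->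
  let z := Num.max x y in
  `|excess_weight p c y - excess_weight p c x| <=
    Num.min (excess_weight p c z)
      (p * excess c z `^ (p - 2) / z ^+ 2 * `|y ^+ 2 - x ^+ 2|).
Proof.
move=> p2 c0 x0 y0 /=; rewrite le_min.
have w0 := excess_weight_ge0 p c.
have [xy|/ltW yx] := leP x y.
  have wxy := ler_excess_weight p2 c0 xy.
  rewrite ger0_norm ?subr_ge0// ger0_norm; last first.
    by rewrite subr_ge0 lerXn2r ?nnegrE.
  by rewrite excess_weight_diff// andbT; have := w0 x; lra.
have wxy := ler_excess_weight p2 c0 yx.
rewrite distrC ger0_norm ?subr_ge0// distrC ger0_norm; last first.
  by rewrite subr_ge0 lerXn2r ?nnegrE.
by rewrite excess_weight_diff// andbT; have := w0 y; lra.
Qed.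

(** Dictionary: x = |W_i|, y = |W|, h = |eps_i b_i|, t = eps_i <b_i, W_i>. Since eps_i <b_i, W> = t
    + h^2, the left side is the i-th term of the expansion minus its centred part t psi(x). *)
Lemma excess_weight_increment p eta : 2 < p -> 0 < eta ->
  exists2 C, 0 < C & forall c x y h t, 0 < c -> 0 <= x -> 0 <= y -> 0 <= h ->
    `|t| <= h * x -> y ^+ 2 = x ^+ 2 + 2 * t + h ^+ 2 ->
    h ^+ 2 * excess_weight p c y
      + t * (excess_weight p c y - excess_weight p c x) <=
    (1 + eta) * h ^+ 2 * excess_weight p c x
      + C * (t ^+ 2 * (excess c x `^ (p - 2) / x ^+ 2)) + C * h `^ p.
Proof.
move=> p2 eta0; have eta2 : 0 < eta / 2 by lra.
have [C1 C10 HC1] := excess_weight_growth p2 eta2.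
pose K := p * 2 `^ (p - 2).
have K0 : 0 < K by rewrite mulr_gt0 ?powR_gt0//; lra.
(* For h at most e times the excess at [x], the excess at [z] is at most doubled, whence the power
   of 2 in [K]; the condition on K e^2 makes the h^4 term below a fraction of h^2 psi(x). *)
have [e [e0 e12 eK]] := ex_small K0 eta2.
have e'0 : 0 < e^-1 by rewrite invr_gt0.
pose C2 := (1 + e^-1) `^ (p - 1).
have C20 : 0 < C2 by rewrite powR_gt0//; lra.
exists (3 * K + C1 + C2); first lra.
move=> c x y h t c0 x0 y0 h0; rewrite ler_norml => /andP[t1 t2] yE.
have yxh : y <= x + h.
  rewrite -ler_sqr ?nnegrE ?addr_ge0// yE; lra.
have xyh : x <= y + h.
  have [xh|hx] := leP x h; first by lra.
  by rewrite -lerBlDr -ler_sqr ?nnegrE// ?yE; lra.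
set Q := t ^+ 2 * _.
have Q0 : 0 <= Q by rewrite mulr_ge0 ?sqr_ge0// divr_ge0 ?powR_ge0 ?sqr_ge0.
have hp0 : 0 <= h `^ p by exact: powR_ge0.
have w0 := excess_weight_ge0 p c.
have H1 : h ^+ 2 * excess_weight p c y <=
    (1 + eta / 2) * h ^+ 2 * excess_weight p c x + C1 * h `^ p.
  apply: (le_trans (ler_wpM2l (sqr_ge0 h) (HC1 c x y h c0 x0 h0 y0 yxh))).
  rewrite (powR_sub2 p2 h0); lra.
suff H2 : t * (excess_weight p c y - excess_weight p c x) <=
    eta / 2 * h ^+ 2 * excess_weight p c x + 3 * K * Q + C2 * h `^ p.
  have := mulr_ge0 (ltW C10) Q0; have := mulr_ge0 (ltW C20) Q0.
  have := mulr_ge0 (ltW K0) hp0; nra.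
have := excess_weight_dist p2 c0 x0 y0; rewrite /= le_min => /andP[].
set z := Num.max x y => Hz Hd.
have xz : x <= z by rewrite le_max lexx.
have zxh : z <= x + h by rewrite ge_max yxh andbT; lra.
have z0 : 0 <= z by lra.
have tx : t * (excess_weight p c y - excess_weight p c x) <=
    `|t| * `|excess_weight p c y - excess_weight p c x|.
  by rewrite -normrM ler_norm.
apply: (le_trans tx).
have ta : `|t| <= h * x by rewrite ler_norml; apply/andP.
have [hx|xh] := leP h (e * excess c x).
- apply: (@le_trans _ _ (eta / 2 * h ^+ 2 * excess_weight p c x + 3 * K * Q)); last first.
    by rewrite lerDl mulr_ge0// ltW.
  have [xc|cx] := leP x c.
    have h00 : h = 0.
      by apply/eqP; rewrite eq_le h0 andbT; move: hx; rewrite excess_eq0// mulr0.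
    have -> : `|t| = 0.
      by apply/eqP; rewrite eq_le normr_ge0 andbT; move: ta; rewrite h00 mul0r.
    rewrite mul0r addr_ge0//; last by apply: mulr_ge0 => //; lra.
    by rewrite h00 expr0n/= mulr0 mul0r.
  have x0' : 0 < x by lra.
  pose G := K * (excess c x `^ (p - 2) / x ^+ 2).
  have G0 : 0 <= G.
    by apply: mulr_ge0; [lra|apply: divr_ge0; [exact: powR_ge0|exact: sqr_ge0]].
  have HG : p * excess c z `^ (p - 2) / z ^+ 2 <= G.
    rewrite /G /K -!mulrA ler_wpM2l//; first lra.
    rewrite mulrA ler_pM ?powR_ge0 ?invr_ge0 ?sqr_ge0//; last first.
      by rewrite lef_pV2 ?posrE ?exprn_gt0//; [rewrite lerXn2r ?nnegrE|lra].
    rewrite -powRM ?excess_ge0// ge0_ler_powR ?nnegrE ?excess_ge0//; first lra.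
      by rewrite mulr_ge0 ?excess_ge0.
    apply: (le_trans (excess_lipschitz c h0 zxh)).
    have := excess_ge0 c x; nra.
  have Hyx : `|y ^+ 2 - x ^+ 2| <= 2 * `|t| + h ^+ 2.
    rewrite yE (_ : _ - _ = 2 * t + h ^+ 2); last by ring.
    by rewrite (le_trans (ler_normD _ _))// normrM ger0_norm// [X in _ + X]ger0_norm ?sqr_ge0.
  have Hd' : `|excess_weight p c y - excess_weight p c x| <=
      G * (2 * `|t| + h ^+ 2).
    apply: (le_trans Hd); apply: ler_pM => //.
    apply: divr_ge0; last exact: sqr_ge0.
    by apply: mulr_ge0; [lra|exact: powR_ge0].
  apply: (le_trans (ler_wpM2l (normr_ge0 t) Hd')).
  have -> : 3 * K * Q = 3 * G * `|t| ^+ 2 by rewrite /Q /G real_normK ?num_real//; ring.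
  have Gh : G * h ^+ 2 <= eta / 2 * excess_weight p c x.
    have hu : h ^+ 2 <= e ^+ 2 * excess c x ^+ 2.
      by rewrite -exprMn lerXn2r ?nnegrE// mulr_ge0 ?excess_ge0// ltW.
    apply: (le_trans (ler_wpM2l G0 hu)).
    have -> : G * (e ^+ 2 * excess c x ^+ 2) = K * e ^+ 2 * excess_weight p c x.
      by rewrite /G /excess_weight (powR_sub2 p2 (excess_ge0 c x)); ring.
    by rewrite ler_wpM2r.
  have : G * h ^+ 2 * h ^+ 2 <= eta / 2 * excess_weight p c x * h ^+ 2.
    by rewrite ler_wpM2r ?sqr_ge0.
  (* Splits the cross term |t| h^2 into t^2, kept, and h^4, absorbed by [Gh]. *)
  have : 0 <= G * (`|t| - h ^+ 2) ^+ 2 by rewrite mulr_ge0 ?sqr_ge0.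
  have : 0 <= G * (h ^+ 2 * h ^+ 2).
    by apply: mulr_ge0 => //; apply: mulr_ge0; exact: sqr_ge0.
  have : 0 <= G * `|t| ^+ 2 by apply: mulr_ge0 => //; exact: sqr_ge0.
  nra.
(* Large increment: the excess at [z] is at most (1 + 1/e) h, so the crude bound by the weight at
   [z] is already of order h^p. *)
- apply: (@le_trans _ _ (C2 * h `^ p)); last first.
    rewrite lerDr addr_ge0//; last by apply: mulr_ge0 => //; lra.
    by apply: mulr_ge0 => //; apply: mulr_ge0; [lra|exact: sqr_ge0].
  have Xz : excess c z <= (1 + e^-1) * h.
    apply: (le_trans (excess_lipschitz c h0 zxh)).
    have : excess c x <= e^-1 * h by rewrite mulrC ler_pdivlMr//; lra.
    lra.
  apply: (@le_trans _ _ (h * (z * excess_weight p c z))).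
    rewrite mulrA ler_pM// ?(le_trans ta)//.
    by rewrite ler_wpM2l.
  have e1 : 0 <= 1 + e^-1 by lra.
  have p1 : 1 < p by lra.
  rewrite (powR_sub1 p1 h0) mulrA mulrC ler_wpM2r// -powRM//.
  apply: (le_trans (mul_excess_weight_le p2 c0 z0)).
  by rewrite ge0_ler_powR ?nnegrE ?excess_ge0 ?mulr_ge0//; lra.
Qed.

(** Carries the quadratic term back from W_i to W, with l = <b_i, W_i>, m = <b_i, W>, a = |b_i|^2.
    Only after this does the same vector W appear for every i, so that the operator bound [r] can
    sum the m^2. *)
Lemma excess_weight_leave_in p eta : 2 < p -> 0 < eta ->
  exists2 C, 0 < C & forall c x y h a l m,
    0 < c -> 0 <= x -> 0 <= y -> 0 <= h -> 0 <= a ->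
    x <= y + h -> y <= x + h ->
    l ^+ 2 <= a * x ^+ 2 -> l ^+ 2 <= 2 * m ^+ 2 + 2 * a * h ^+ 2 ->
    l ^+ 2 * (excess c x `^ (p - 2) / x ^+ 2) <=
    C * (m ^+ 2 * (excess c y `^ (p - 2) / y ^+ 2))
      + eta * a * excess_weight p c y + C * a * h `^ (p - 2).
Proof.
move=> p2 eta0.
(* 2^(p-2) comes from doubling the excess, 4 from x >= y / 2, and 2 from the bound of l^2 by m^2. *)
pose K := 8 * 2 `^ (p - 2).
have K0 : 0 < K by rewrite mulr_gt0 ?powR_gt0//; lra.
have [e [e0 e12 eK]] := ex_small K0 eta0.
have e'0 : 0 < e^-1 by rewrite invr_gt0.
pose C2 := (1 + e^-1) `^ (p - 2).
have C20 : 0 < C2 by rewrite powR_gt0//; lra.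
exists (K + C2); first lra.
move=> c x y h a l m c0 x0 y0 h0 a0 xyh yxh la lm.
set Q := m ^+ 2 * _.
have Q0 : 0 <= Q by rewrite mulr_ge0 ?sqr_ge0// divr_ge0 ?powR_ge0 ?sqr_ge0.
have hp0 : 0 <= h `^ (p - 2) by exact: powR_ge0.
have w0 := excess_weight_ge0 p c.
have ah : 0 <= a * h `^ (p - 2) by rewrite mulr_ge0.
have aw : 0 <= eta * a * excess_weight p c y.
  by apply: mulr_ge0 => //; apply: mulr_ge0 => //; lra.
have KQ : 0 <= K * Q by rewrite mulr_ge0// ltW.
have CQ : 0 <= C2 * Q by rewrite mulr_ge0// ltW.
have Kah : 0 <= K * (a * h `^ (p - 2)) by rewrite mulr_ge0// ltW.
have Cah : 0 <= C2 * (a * h `^ (p - 2)) by rewrite mulr_ge0// ltW.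
have [hy|yh] := leP h (e * excess c y); last first.
  suff : l ^+ 2 * (excess c x `^ (p - 2) / x ^+ 2) <= C2 * (a * h `^ (p - 2)) by lra.
  have Xx : excess c x `^ (p - 2) <= C2 * h `^ (p - 2).
    rewrite -powRM//; last lra.
    rewrite ge0_ler_powR ?nnegrE ?excess_ge0//; first lra.
      by rewrite mulr_ge0//; lra.
    apply: (le_trans (excess_lipschitz c h0 xyh)).
    have : excess c y <= e^-1 * h by rewrite mulrC ler_pdivlMr//; lra.
    lra.
  have [xc|cx] := leP x c.
    by rewrite excess_eq0// powR0 ?mul0r ?mulr0//; rewrite gt_eqF//; lra.
  have x0' : 0 < x ^+ 2 by rewrite exprn_gt0//; lra.
  have la' : l ^+ 2 / x ^+ 2 <= a by rewrite ler_pdivrMr.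
  rewrite (mulrCA C2) (mulrA (l ^+ 2)) (mulrAC (l ^+ 2)); apply: ler_pM => //.
    by rewrite divr_ge0 ?sqr_ge0.
  exact: powR_ge0.
have [yc|cy] := leP y c.
  have h00 : h = 0.
    by apply/eqP; rewrite eq_le h0 andbT; move: hy; rewrite excess_eq0// mulr0.
  rewrite (@excess_eq0 _ c x); last lra.
  rewrite powR0; last by rewrite gt_eqF//; lra.
  by rewrite mul0r mulr0; lra.
have y0' : 0 < y by lra.
have Xy : excess c y <= y by apply: excess_le => //; lra.
have Xy0 := excess_ge0 c y.
have h2y : h <= y / 2 by nra.
have x0' : 0 < x by lra.
pose G := 2 `^ (p - 2) * excess c y `^ (p - 2) * (4 / y ^+ 2).
have HG : excess c x `^ (p - 2) / x ^+ 2 <= G.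
  rewrite /G ler_pM ?powR_ge0 ?invr_ge0 ?sqr_ge0//.
    rewrite -powRM// ge0_ler_powR ?nnegrE ?excess_ge0 ?mulr_ge0//; first lra.
    by apply: (le_trans (excess_lipschitz c h0 xyh)); nra.
  rewrite ler_pdivlMr ?exprn_gt0// mulrC ler_pdivrMr ?exprn_gt0//.
  have -> : 4 * x ^+ 2 = (2 * x) ^+ 2 by ring.
  by rewrite lerXn2r ?nnegrE//; lra.
have G0 : 0 <= G.
  apply: mulr_ge0; first by apply: mulr_ge0; exact: powR_ge0.
  by apply: divr_ge0 => //; exact: sqr_ge0.
have Gh : G * h ^+ 2 * 2 <= eta * excess_weight p c y.
  have hu : h ^+ 2 <= e ^+ 2 * excess c y ^+ 2.
    by rewrite -exprMn lerXn2r ?nnegrE// mulr_ge0// ltW.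
  apply: (@le_trans _ _ (G * (e ^+ 2 * excess c y ^+ 2) * 2)).
    by rewrite ler_wpM2r// ler_wpM2l.
  have -> : G * (e ^+ 2 * excess c y ^+ 2) * 2 = K * e ^+ 2 * excess_weight p c y.
    by rewrite /G /K /excess_weight (powR_sub2 p2 (excess_ge0 c y)); ring.
  by rewrite ler_wpM2r.
have GQ : 2 * m ^+ 2 * G = K * Q by rewrite /G /K /Q; ring.
have GQ' : 2 * a * h ^+ 2 * G <= eta * a * excess_weight p c y.
  have -> : 2 * a * h ^+ 2 * G = a * (G * h ^+ 2 * 2) by ring.
  have -> : eta * a * excess_weight p c y = a * (eta * excess_weight p c y) by ring.
  by rewrite ler_wpM2l.
have : l ^+ 2 * (excess c x `^ (p - 2) / x ^+ 2) <=
    (2 * m ^+ 2 + 2 * a * h ^+ 2) * G.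
  by rewrite ler_pM ?sqr_ge0 ?divr_ge0 ?powR_ge0 ?sqr_ge0.
lra.
Qed.

(** By cases: either r <= eta u^2, or u^2 < r / eta and u^(p-2) is at most (r / eta)^(p/2 - 1). The
    exponent p/2 reflects that [r] scales like a square. *)
Lemma mul_powR_young p eta : 2 < p -> 0 < eta ->
  exists2 C, 0 < C & forall r u : R, 0 <= r -> 0 <= u ->
    r * u `^ (p - 2) <= eta * u `^ p + C * r `^ (p / 2).
Proof.
move=> p2 eta0; have e'0 : 0 < eta^-1 by rewrite invr_gt0.
exists (eta^-1 `^ (p / 2 - 1)); first exact: powR_gt0.
move=> r u r0 u0.
have H1 : 0 <= eta * u `^ p by rewrite mulr_ge0 ?powR_ge0// ltW.
have H2 : 0 <= eta^-1 `^ (p / 2 - 1) * r `^ (p / 2) by rewrite mulr_ge0 ?powR_ge0.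
have [ru|ur] := leP r (eta * u ^+ 2).
  have : r * u `^ (p - 2) <= eta * u `^ p.
    by rewrite (powR_sub2 p2 u0) mulrCA mulrC ler_wpM2l ?powR_ge0.
  lra.
suff : r * u `^ (p - 2) <= eta^-1 `^ (p / 2 - 1) * r `^ (p / 2) by lra.
have p21 : 1 < p / 2 by lra.
rewrite (powR_sub1 p21 r0) mulrA mulrC ler_wpM2r// -powRM//; last lra.
have -> : p - 2 = 2 * (p / 2 - 1) by lra.
rewrite powRrM powR_mulrn// ge0_ler_powR ?nnegrE ?sqr_ge0 ?mulr_ge0//; try lra.
by rewrite mulrC ler_pdivlMr// mulrC ltW.
Qed.

End leave_one_out_increments.

(** * The leave-one-out moment inequality *)

Section nonnegative_integral.
Context d (T : measurableType d) (R : realType) (mu : {measure set T -> \bar R}).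
Implicit Types (f g : T -> R).
Local Notation Int f := (\int[mu]_w (f w)%:E)%E.

Lemma Int_ge0 f : (forall w, 0 <= f w) -> (0 <= Int f)%E.
Proof. by move=> f0; apply: integral_ge0 => w _; rewrite lee_fin. Qed.

Lemma le_Int f g : measurable_fun setT f -> measurable_fun setT g ->
  (forall w, 0 <= f w) -> (forall w, f w <= g w) -> (Int f <= Int g)%E.
Proof.
move=> mf mg f0 fg; apply: ge0_le_integral => //.
- by move=> w _; rewrite lee_fin.
- exact/measurable_EFinP.
- exact/measurable_EFinP.
- by move=> w _; rewrite lee_fin.
Qed.

Lemma IntD f g : measurable_fun setT f -> measurable_fun setT g ->
  (forall w, 0 <= f w) -> (forall w, 0 <= g w) ->
  Int (fun w => f w + g w) = (Int f + Int g)%E.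
Proof.
move=> mf mg f0 g0; under eq_integral do rewrite EFinD.
rewrite ge0_integralD//.
- by move=> w _; rewrite lee_fin.
- exact/measurable_EFinP.
- by move=> w _; rewrite lee_fin.
- exact/measurable_EFinP.
Qed.

Lemma IntZ k f : 0 <= k -> measurable_fun setT f -> (forall w, 0 <= f w) ->
  Int (fun w => k * f w) = (k%:E * Int f)%E.
Proof.
move=> k0 mf f0; under eq_integral do rewrite EFinM.
rewrite ge0_integralZl//.
- exact/measurable_EFinP.
- by move=> w _; rewrite lee_fin.
Qed.

Lemma Int_sum (I : finType) (f : I -> T -> R) :
  (forall i, measurable_fun setT (f i)) -> (forall i w, 0 <= f i w) ->
  Int (fun w => \sum_i f i w) = (\sum_i Int (f i))%E.
Proof.
move=> mf f0; under eq_integral do rewrite -sumEFin.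
rewrite ge0_integral_sum//.
- by move=> i; exact/measurable_EFinP.
- by move=> i w _; rewrite lee_fin.
Qed.

End nonnegative_integral.

Lemma Int_cst d (T : measurableType d) (R : realType) (Pr : probability T R) k :
  (\int[Pr]_w k%:E = k%:E)%E.
Proof.
rewrite integral_cst; last exact: measurableT.
by rewrite [X in (_ * X)%E]probability_setT mule1.
Qed.

(* The positive part of a product of independent variables splits into products
   of independent nonnegative ones, whose integrals factor without any
   integrability condition. *)
Lemma max0M (R : realDomainType) (x y : R) :
  Num.max (x * y) 0 =
    Num.max x 0 * Num.max y 0 + Num.max (- x) 0 * Num.max (- y) 0.
Proof.
have pos0 (a : R) : 0 <= a -> (Num.max a 0 = a) * (Num.max (- a) 0 = 0).
  by move=> a0; split; [apply/max_idPl|apply/max_idPr; rewrite oppr_le0].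
have neg0 (a : R) : a <= 0 -> (Num.max a 0 = 0) * (Num.max (- a) 0 = - a).
  by move=> a0; split; [apply/max_idPr|apply/max_idPl; rewrite oppr_ge0].
have [x0|/ltW x0] := leP 0 x; have [y0|/ltW y0] := leP 0 y.
- by rewrite !pos0 ?mulr_ge0// mulr0 addr0.
- by rewrite neg0 ?mulr_ge0_le0// !(pos0 x)// !(neg0 y)// mulr0 mul0r addr0.
- by rewrite neg0 ?mulr_le0_ge0// !(neg0 x)// !(pos0 y)// mulr0 mul0r addr0.
- by rewrite pos0 ?mulr_le0// !neg0// mul0r add0r mulrNN.
Qed.

Section leave_one_out_bound.
Context d (T : measurableType d) (R : realType) (Pr : probability T R).
Context (I : finType) (X : I -> {RV Pr >-> R}).
Local Notation Int f := (\int[Pr]_w (f w)%:E)%E.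
Local Notation pos f := (fun w => Num.max (f w) 0).
Local Notation neg f := (fun w => Num.max (- f w) 0).

Lemma measurable_pos d' (T' : measurableType d') (f : T' -> R) :
  measurable_fun setT f -> measurable_fun setT (pos f).
Proof. by move=> mf; apply: measurable_maxr. Qed.

Lemma measurable_neg d' (T' : measurableType d') (f : T' -> R) :
  measurable_fun setT f -> measurable_fun setT (neg f).
Proof. by move=> mf; apply: measurable_maxr => //; exact: measurable_funN. Qed.

Lemma Int_pos_neg (f : T -> R) : measurable_fun setT f ->
  Int f = 0%E -> (Int (fun w => `|f w|)%R < +oo)%E ->
  exists2 e : R, Int (pos f) = e%:E & Int (neg f) = e%:E.
Proof.
move=> mf f0 fi.
have H (g : T -> R) : measurable_fun setT g -> (forall w, 0 <= g w) ->
    (forall w, g w <= `|f w|) -> Int g \is a fin_num.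
  move=> mg g0 gf; rewrite ge0_fin_numE ?Int_ge0//.
  by apply: le_lt_trans fi; apply: le_Int => //; exact: measurableT_comp.
have pf : Int (pos f) \is a fin_num.
  apply: H; first exact: measurable_pos.
    by move=> w; rewrite le_max lexx orbT.
  by move=> w; rewrite ge_max ler_norm normr_ge0.
have nf : Int (neg f) \is a fin_num.
  apply: H; first exact: measurable_neg.
    by move=> w; rewrite le_max lexx orbT.
  by move=> w; rewrite ge_max -normrN ler_norm normr_ge0.
exists (fine (Int (pos f))); first by rewrite fineK.
move: f0; rewrite integralE.
have -> : (\int[Pr]_w ((fun w => (f w)%:E)^\+ w) = Int (pos f))%E.
  by apply: eq_integral => w _; rewrite funeposE -EFin_max.
have -> : (\int[Pr]_w ((fun w => (f w)%:E)^\- w) = Int (neg f))%E.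
  by apply: eq_integral => w _; rewrite funenegE -EFinN -EFin_max.
move: pf nf => /fineK {1 2}<- /fineK <-; rewrite -EFinB => -[] /eqP.
by rewrite subr_eq0 => /eqP ->.
Qed.

Hypothesis indep : mutually_independent X.
Hypothesis X_mean : forall i, Int (X i) = 0%E.
Hypothesis X_var : forall i, Int (fun w => X i w ^+ 2) = 1%E.
Hypothesis X_fin : forall i, (Int (fun w => `|X i w|)%R < +oo)%E.

Let others i := g_sigma_algebraType (cylinders X i).

(** That X_i F has mean zero, phrased as equality of two finite integrals of nonnegative functions,
    so that it can be cancelled between the two sides of an inequality in the extended reals. *)
Lemma Int_centered i (F : T -> R) :
  measurable_fun (setT : set (others i)) (F : others i -> R) ->
  (Int (fun w => `|F w|)%R < +oo)%E ->
  exists2 e : R, Int (pos (fun w => X i w * F w)) = e%:E &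
    Int (neg (fun w => X i w * F w)) = e%:E.
Proof.
move=> mF Fi.
have mFT := measurable_fun_other_coords mF.
have [e pe ne] := Int_pos_neg (measurable_funPT (X i)) (X_mean i) (X_fin i).
have H (G : T -> R) : measurable_fun (setT : set (others i)) (G : others i -> R) ->
    (forall w, 0 <= G w) -> (forall w, G w <= `|F w|) ->
    exists2 g : R, Int (fun w => pos (X i) w * G w) = g%:E &
      Int (fun w => neg (X i) w * G w) = g%:E.
  move=> mG G0 GF; have mGT := measurable_fun_other_coords mG.
  have Gf : Int G \is a fin_num.
    rewrite ge0_fin_numE ?Int_ge0//.
    by apply: le_lt_trans Fi; apply: le_Int => //; exact: measurableT_comp.
  exists (e * fine (Int G)).
    rewrite (integral_independent indep (f := fun x => Num.max x 0))//.
    - by rewrite pe EFinM fineK.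
    - exact: measurable_pos.
    - by move=> w; rewrite le_max lexx orbT.
  rewrite (integral_independent indep (f := fun x => Num.max (- x) 0))//.
  - by rewrite ne EFinM fineK.
  - exact: measurable_neg.
  - by move=> w; rewrite le_max lexx orbT.
have [g1 p1 n1] := H (pos F) (measurable_pos mF)
  (fun w => ltac:(by rewrite le_max lexx orbT))
  (fun w => ltac:(by rewrite ge_max ler_norm normr_ge0)).
have [g2 p2 n2] := H (neg F) (measurable_neg mF)
  (fun w => ltac:(by rewrite le_max lexx orbT))
  (fun w => ltac:(by rewrite ge_max -normrN ler_norm normr_ge0)).
have mX := measurable_funPT (X i).
have max0 (x : R) : 0 <= Num.max x 0 by rewrite le_max lexx orbT.
exists (g1 + g2).
  rewrite EFinD -p1 -n2 -IntD//.
  - apply: eq_integral => w _; congr EFin; set x := X i w; set y := F w.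
    by rewrite max0M.
  - by apply: measurable_funM; exact: measurable_pos.
  - by apply: measurable_funM; exact: measurable_neg.
  - by move=> w; rewrite mulr_ge0.
  - by move=> w; rewrite mulr_ge0.
rewrite EFinD -n1 -p2 -IntD//.
- apply: eq_integral => w _; congr EFin; set x := X i w; set y := F w.
  by rewrite -mulNr max0M opprK addrC.
- by apply: measurable_funM; [exact: measurable_neg|exact: measurable_pos].
- by apply: measurable_funM; [exact: measurable_pos|exact: measurable_neg].
- by move=> w; rewrite mulr_ge0.
- by move=> w; rewrite mulr_ge0.
Qed.

(** The absorption scheme in the abstract. In expectation X_i^2 A_i becomes A_i by independence and
    unit variance, X_i F_i disappears, and the sum of the A_i returns at most [kappa] times the left
    side. *)
Lemma leave_one_out_bound (A F : I -> T -> R) (U Z Z' : T -> R) (kappa : R) :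
  (forall i, measurable_fun (setT : set (others i)) (A i : others i -> R)) ->
  (forall i w, 0 <= A i w) ->
  (forall i, measurable_fun (setT : set (others i)) (F i : others i -> R)) ->
  (forall i, Int (fun w => `|F i w|)%R < +oo)%E ->
  measurable_fun setT U -> (forall w, 0 <= U w) -> (Int U < +oo)%E ->
  measurable_fun setT Z -> (forall w, 0 <= Z w) ->
  measurable_fun setT Z' -> (forall w, 0 <= Z' w) ->
  0 <= kappa -> kappa <= 1 ->
  (forall w, U w <= \sum_i (X i w ^+ 2 * A i w + X i w * F i w) + Z w) ->
  (forall w, \sum_i A i w <= kappa * U w + Z' w) ->
  ((1 - kappa)%:E * Int U <= Int Z + Int Z')%E.
Proof.
move=> mA A0 mF Fi mU U0 Ui mZ Z0 mZ' Z'0 k0 k1 UA AU.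
have mX i := measurable_funPT (X i).
have mAT i := measurable_fun_other_coords (mA i).
have mFT i := measurable_fun_other_coords (mF i).
have /choice[e He] i : exists e : R, Int (pos (fun w => X i w * F i w)) = e%:E
    /\ Int (neg (fun w => X i w * F i w)) = e%:E.
  by have [e pe ne] := Int_centered (mF i) (Fi i); exists e.
have mXF i : measurable_fun setT (fun w => X i w * F i w).
  exact: measurable_funM.
have mX2A i : measurable_fun setT (fun w => X i w ^+ 2 * A i w).
  by apply: measurable_funM => //; exact: measurable_funX.
have max0 (x : R) : 0 <= Num.max x 0 by rewrite le_max lexx orbT.
pose V w := \sum_i A i w.
have V0 w : 0 <= V w by rewrite sumr_ge0.
have mV : measurable_fun setT V by exact: measurable_sum.
have X2A0 i w : 0 <= X i w ^+ 2 * A i w by rewrite mulr_ge0 ?sqr_ge0.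
have mneg := measurable_sum (index_enum I) (fun i => measurable_neg (mXF i)).
have mpos := measurable_sum (index_enum I) (fun i => measurable_pos (mXF i)).
have mX2As := measurable_sum (index_enum I) mX2A.
have sneg0 w : 0 <= \sum_i Num.max (- (X i w * F i w)) 0 by rewrite sumr_ge0.
have spos0 w : 0 <= \sum_i Num.max (X i w * F i w) 0 by rewrite sumr_ge0.
have sX2A0 w : 0 <= \sum_i X i w ^+ 2 * A i w by rewrite sumr_ge0.
(* The negative parts of the X_i F_i are moved to the left, so that every integrand is
   nonnegative. *)
have : (Int (fun w => U w + \sum_i Num.max (- (X i w * F i w)) 0)%R <=
    Int (fun w => \sum_i X i w ^+ 2 * A i w + Z w
      + \sum_i Num.max (X i w * F i w) 0)%R)%E.
  apply: le_Int.
  - exact: measurable_funD.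
  - by apply: measurable_funD => //; exact: measurable_funD.
  - by move=> w; rewrite addr_ge0.
  move=> w; have := UA w; rewrite big_split/=.
  suff -> : \sum_i X i w * F i w = \sum_i Num.max (X i w * F i w) 0 -
    \sum_i Num.max (- (X i w * F i w)) 0 by lra.
  rewrite -sumrB; apply: eq_bigr => i _; set x := X i w * F i w.
  have [x0|/ltW x0] := leP 0 x.
    by rewrite (_ : Num.max (- x) 0 = 0) ?subr0//; apply/max_idPr; lra.
  by rewrite (_ : Num.max (- x) 0 = - x) ?opprK ?add0r//; apply/max_idPl; lra.
have sX2AZ0 w : 0 <= \sum_i X i w ^+ 2 * A i w + Z w by rewrite addr_ge0.
rewrite (IntD Pr mU mneg)// (IntD Pr (measurable_funD mX2As mZ) mpos)//.
rewrite (IntD Pr mX2As mZ)// !Int_sum//; last 2 first.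
- by move=> i; exact: measurable_pos.
- by move=> i; exact: measurable_neg.
under eq_bigr do rewrite (He _).2.
under [X in (_ <= _ + X)%E -> _]eq_bigr do rewrite (He _).1.
have -> : (\sum_i Int (fun w => X i w ^+ 2 * A i w)%R = Int V)%E.
  rewrite /V Int_sum//; apply: eq_bigr => i _.
  rewrite (integral_independent indep (f := fun x => x ^+ 2))//.
  - by rewrite X_var mul1e.
  - by move=> x; exact: sqr_ge0.
rewrite sumEFin.
have : (Int V <= kappa%:E * Int U + Int Z')%E.
  rewrite -IntZ// -IntD//.
  - apply: le_Int => //; apply: measurable_funD => //.
    exact: measurable_funM.
  - exact: measurable_funM.
  - by move=> w; exact: mulr_ge0.
(* Finiteness of this integral is what permits subtracting its multiple by [kappa]; the other three
   may be infinite and are treated by cases. *)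
have Ufin : Int U \is a fin_num by rewrite ge0_fin_numE ?Int_ge0.
rewrite -(fineK Ufin).
move: (Int_ge0 Pr V0) (Int_ge0 Pr Z0) (Int_ge0 Pr Z'0).
move: (Int Z) (Int Z') (Int V) => [z| |] [z'| |] [v| |]//;
  rewrite ?addey ?addye ?leey// -?EFinM -?EFinD ?lee_fin; try lra.
Qed.

End leave_one_out_bound.

(** * Euclidean norms and the vector form of the leave-one-out expansion *)

Section euclidean_norm.
Context {R : realType}.

Definition dot k (u v : 'cV[R]_k) : R := \sum_i u i 0 * v i 0.

Definition enorm k (u : 'cV[R]_k) : R := Num.sqrt (dot u u).

Lemma dotC k (u v : 'cV[R]_k) : dot u v = dot v u.
Proof. by apply: eq_bigr => i _; rewrite mulrC. Qed.

Lemma dotDl k (u v w : 'cV[R]_k) : dot (u + v) w = dot u w + dot v w.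
Proof. by rewrite /dot -big_split; apply: eq_bigr => i _; rewrite mxE mulrDl. Qed.

Lemma dotZl k a (u v : 'cV[R]_k) : dot (a *: u) v = a * dot u v.
Proof. by rewrite /dot mulr_sumr; apply: eq_bigr => i _; rewrite mxE mulrA. Qed.

Lemma dotDr k (u v w : 'cV[R]_k) : dot w (u + v) = dot w u + dot w v.
Proof. by rewrite dotC dotDl !(dotC w). Qed.

Lemma dotZr k a (u v : 'cV[R]_k) : dot v (a *: u) = a * dot v u.
Proof. by rewrite dotC dotZl dotC. Qed.

Lemma dotBl k (u v w : 'cV[R]_k) : dot (u - v) w = dot u w - dot v w.
Proof. by rewrite dotDl -scaleN1r dotZl mulN1r. Qed.

Lemma dotBr k (u v w : 'cV[R]_k) : dot w (u - v) = dot w u - dot w v.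
Proof. by rewrite dotC dotBl !(dotC w). Qed.

Lemma dot_ge0 k (u : 'cV[R]_k) : 0 <= dot u u.
Proof. by apply: sumr_ge0 => i _; rewrite -expr2 sqr_ge0. Qed.

Lemma dot_sqr_eq0 k (u : 'cV[R]_k) : (dot u u == 0) = (u == 0).
Proof.
apply/eqP/eqP => [/eqP|->]; last by apply: big1 => i _; rewrite mxE mul0r.
rewrite psumr_eq0 => [/allP h|i _]; last by rewrite -expr2 sqr_ge0.
apply/colP => i; have := h i (mem_index_enum i).
by rewrite -expr2 sqrf_eq0 mxE => /eqP.
Qed.

Lemma dot0 k (u : 'cV[R]_k) : dot u 0 = 0.
Proof. by apply: big1 => i _; rewrite mxE mulr0. Qed.

Lemma sqr_enorm k (u : 'cV[R]_k) : enorm u ^+ 2 = dot u u.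
Proof. by rewrite sqr_sqrtr ?dot_ge0. Qed.

Lemma enorm_ge0 k (u : 'cV[R]_k) : 0 <= enorm u.
Proof. exact: sqrtr_ge0. Qed.

Lemma cauchy_schwarz k (u v : 'cV[R]_k) : dot u v ^+ 2 <= dot u u * dot v v.
Proof.
have [/eqP|v0] := eqVneq (dot v v) 0.
  by rewrite dot_sqr_eq0 => /eqP ->; rewrite !dot0 expr0n mulr0.
have vv : 0 < dot v v by rewrite lt_def v0 dot_ge0.
have := dot_ge0 (dot v v *: u + (- dot u v) *: v).
rewrite dotDl !dotDr !dotZl !dotZr (dotC v u).
set a := dot u u; set b := dot v v in vv *; set x := dot u v.
have -> : b * (b * a) + b * (- x * x) + (- x * (b * x) + - x * (- x * b)) =
  b * (a * b - x ^+ 2) by ring.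
by rewrite pmulr_rge0// subr_ge0.
Qed.

Lemma dot_le_enorm k (u v : 'cV[R]_k) : `|dot u v| <= enorm u * enorm v.
Proof.
rewrite -(@ler_pXn2r _ 2)// ?nnegrE ?mulr_ge0 ?enorm_ge0//.
by rewrite real_normK ?num_real// exprMn !sqr_enorm cauchy_schwarz.
Qed.

End euclidean_norm.

Section leave_one_out_vectors.
Context {R : realType}.
Implicit Types (p c eta : R).

Definition combine k n (B : 'M[R]_(k, n)) (e : 'I_n -> R) : 'cV[R]_k :=
  B *m \col_i e i.

(** Zeroing a coordinate, instead of removing it, keeps the index type and the matrix [B]. *)
Definition leave_out n (i : 'I_n) (e : 'I_n -> R) : 'I_n -> R :=
  fun j => if j == i then 0 else e j.

Lemma combine_leave_out k n (B : 'M[R]_(k, n)) (e : 'I_n -> R) i :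
  combine B e = combine B (leave_out i e) + e i *: col i B.
Proof.
apply/colP => j; rewrite !mxE (bigD1 i)//= [X in _ = X + _](bigD1 i)//=.
rewrite !mxE /leave_out eqxx mulr0 add0r addrC mulrC; congr (_ + _).
by apply: eq_bigr => l /negbTE li; rewrite !mxE li.
Qed.

Lemma dot_combine k n (B : 'M[R]_(k, n)) (e : 'I_n -> R) v :
  dot (combine B e) v = \sum_i e i * dot (col i B) v.
Proof.
rewrite /dot; under [RHS]eq_bigr do rewrite mulr_sumr.
rewrite exchange_big; apply: eq_bigr => j _; rewrite mxE mulr_suml.
by apply: eq_bigr => i _; rewrite !mxE mulrAC mulrC mulrA (mulrC (e i)).
Qed.

(** The factor of e_i^2 in the expansion, evaluated at v = W_i: its first part sums to about t psi,
    its second is controlled by [r]. *)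
Definition leave_out_weight k p c eta C (b v : 'cV[R]_k) :=
  (1 + eta) * dot b b * excess_weight p c (enorm v) +
  C * (dot b v ^+ 2 * (excess c (enorm v) `^ (p - 2) / enorm v ^+ 2)).

Lemma powR_half_sqr (a p : R) : 0 <= a -> (a ^+ 2) `^ (p / 2) = a `^ p.
Proof. by move=> a0; rewrite -powR_mulrn// -powRrM mulrC divfK. Qed.

Lemma leave_out_enorm k n (B : 'M[R]_(k, n)) (e : 'I_n -> R) i :
  let b := col i B in let v := combine B (leave_out i e) in
  let h := `|e i| * enorm b in
  [/\ enorm (combine B e) ^+ 2 = enorm v ^+ 2 + 2 * (e i * dot b v) + h ^+ 2,
      dot b (combine B e) = dot b v + e i * dot b b,
      `|e i * dot b v| <= h * enorm v &
      enorm (combine B e) <= enorm v + h /\ enorm v <= enorm (combine B e) + h].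
Proof.
move=> b v h.
have h0 : 0 <= h by rewrite mulr_ge0 ?enorm_ge0.
have hE : h ^+ 2 = e i ^+ 2 * dot b b.
  by rewrite /h exprMn real_normK ?num_real// sqr_enorm.
have E1 : enorm (combine B e) ^+ 2 = enorm v ^+ 2 + 2 * (e i * dot b v) + h ^+ 2.
  rewrite !sqr_enorm (combine_leave_out B e i) hE.
  by rewrite dotDl !dotDr !dotZl !dotZr (dotC v b); ring.
have E3 : `|e i * dot b v| <= h * enorm v.
  by rewrite normrM -mulrA ler_wpM2l// dot_le_enorm.
split=> //; first by rewrite (combine_leave_out B e i) dotDr dotZr.
move: E3; rewrite ler_norml => /andP[t1 t2].
have x0 := enorm_ge0 v; have y0 := enorm_ge0 (combine B e).
split; first by rewrite -ler_sqr ?nnegrE ?addr_ge0// E1; lra.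
have [xh|hx] := leP (enorm v) h; first by lra.
by rewrite -lerBlDr -ler_sqr ?nnegrE// ?E1; lra.
Qed.

Lemma leave_out_upper p eta : 2 < p -> 0 < eta ->
  exists2 C, 0 < C & forall c k n (B : 'M[R]_(k, n)) (e : 'I_n -> R), 0 < c ->
  excess c (enorm (combine B e)) `^ p <=
  \sum_i (e i ^+ 2 *
            leave_out_weight p c eta C (col i B) (combine B (leave_out i e)) +
          e i * (dot (col i B) (combine B (leave_out i e)) *
                 excess_weight p c (enorm (combine B (leave_out i e))))) +
  C * \sum_i enorm (col i B) `^ p * `|e i| `^ p.
Proof.
move=> p2 eta0; have [C C0 HC] := excess_weight_increment p2 eta0.
exists C => // c k n B e c0.
have p0 : 0 < p by lra.
rewrite -mul_excess_weight ?enorm_ge0// sqr_enorm {1}dot_combine mulr_suml.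
rewrite mulr_sumr -big_split/=; apply: ler_sum => i _.
have [E1 E2 E3 _] := leave_out_enorm B e i.
have h0 : 0 <= `|e i| * enorm (col i B) by rewrite mulr_ge0 ?enorm_ge0.
have := HC c _ _ _ _ c0 (enorm_ge0 _) (enorm_ge0 _) h0 E3 E1.
rewrite E2 /leave_out_weight powRM ?enorm_ge0//.
rewrite !exprMn real_normK ?num_real// (sqr_enorm (col i B)); lra.
Qed.

(** Each part of the weight is transported from W_i to W; then the sum of <b_i, W>^2 is at most r
    |W|^2, which cancels the denominator. The losses add up to (1 + eta)^2 + eta <= 1 + 4 eta. *)
Lemma leave_out_lower p eta C : 2 < p -> 0 < eta -> eta <= 1 -> 0 < C ->
  exists2 C', 0 < C' & forall c k n (B : 'M[R]_(k, n)) (e : 'I_n -> R) (r : R),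
  0 < c -> 0 <= r -> (forall v, \sum_i dot (col i B) v ^+ 2 <= r * dot v v) ->
  \sum_i leave_out_weight p c eta C (col i B) (combine B (leave_out i e)) <=
  (1 + 4 * eta) * (\sum_i dot (col i B) (col i B)) *
    excess_weight p c (enorm (combine B e)) +
  C' * (r * excess c (enorm (combine B e)) `^ (p - 2)) +
  C' * \sum_i enorm (col i B) `^ p * (1 + `|e i| `^ p).
Proof.
move=> p2 eta0 eta1 C0.
have [C1 C10 HC1] := excess_weight_growth p2 eta0.
(* The second part carries the factor [C], so its transport is made with eta / C to cost eta. *)
have etaC : 0 < eta / C by exact: divr_gt0.
have [C2 C20 HC2] := excess_weight_leave_in p2 etaC.
have p20 : 0 <= p - 2 by lra.
have p2p : p - 2 <= p by lra.
have eta10 : 0 < 1 + eta by lra.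
have eta11 : 0 <= 1 - eta by lra.
have eta12 : 0 <= eta by lra.
have CC0 : 0 <= C * C2 by rewrite mulr_ge0// ltW.
have eC0 : 0 <= (1 + eta) * C1 by rewrite mulr_ge0// ltW.
exists (C * C2 + (1 + eta) * C1).
  by rewrite addr_gt0 ?mulr_gt0.
move=> c k n B e r c0 r0 hr.
set y := enorm (combine B e); set w := excess_weight p c y.
set X := excess c y `^ (p - 2).
have w0 : 0 <= w by exact: excess_weight_ge0.
have X0 : 0 <= X by exact: powR_ge0.
have y0 : 0 <= y by exact: enorm_ge0.
have rX : \sum_i (dot (col i B) (combine B e) ^+ 2 * (X / y ^+ 2)) <= r * X.
  rewrite -mulr_suml.
  have [yy|yy] := eqVneq (y ^+ 2) 0.
    by rewrite yy invr0 !mulr0 mulr_ge0.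
  rewrite mulrA mulrAC ler_wpM2r// ler_pdivrMr; last by rewrite lt_def yy sqr_ge0.
  by rewrite sqr_enorm.
pose D i := enorm (col i B) `^ p * (1 + `|e i| `^ p).
suff step i : leave_out_weight p c eta C (col i B) (combine B (leave_out i e)) <=
    (1 + 4 * eta) * dot (col i B) (col i B) * w +
    (C * C2) * (dot (col i B) (combine B e) ^+ 2 * (X / y ^+ 2)) +
    (C * C2 + (1 + eta) * C1) * D i.
  apply: (le_trans (ler_sum _ (fun i _ => step i))).
  rewrite !big_split/= -!mulr_suml -!mulr_sumr lerD2r lerD2l.
  apply: (le_trans (ler_wpM2l CC0 _)); first exact: rX.
  by rewrite ler_wpM2r ?mulr_ge0// lerDl.
have [E1 E2 E3 [yxh xyh]] := leave_out_enorm B e i.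
set b := col i B in E1 E2 E3 yxh xyh *; set v := combine B (leave_out i e) in E1 E2 E3 yxh xyh *.
have h0 : 0 <= `|e i| * enorm b by rewrite mulr_ge0 ?enorm_ge0.
set h := `|e i| * enorm b in E1 E3 yxh xyh h0.
have hE : h ^+ 2 = e i ^+ 2 * dot b b.
  by rewrite /h exprMn real_normK ?num_real// sqr_enorm.
have G1 := HC1 c y (enorm v) h c0 y0 h0 (enorm_ge0 _) xyh.
have lv : dot b v ^+ 2 <= dot b b * enorm v ^+ 2 by rewrite sqr_enorm cauchy_schwarz.
have lm : dot b v ^+ 2 <= 2 * dot b (combine B e) ^+ 2 + 2 * dot b b * h ^+ 2.
  rewrite E2 hE; have := sqr_ge0 (dot b v + 2 * (e i * dot b b)); lra.
have G2 := HC2 c (enorm v) y h (dot b b) _ _ c0 (enorm_ge0 _) y0 h0 (dot_ge0 _) xyh yxh lv lm.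
have hD : dot b b * h `^ (p - 2) <= D i.
  rewrite -sqr_enorm /h powRM ?enorm_ge0// /D (powR_sub2 p2 (enorm_ge0 b)).
  rewrite mulrCA mulrC (mulrC (enorm b ^+ 2)).
  apply: ler_wpM2l; first by rewrite mulr_ge0 ?powR_ge0 ?sqr_ge0.
  exact: powR_le1D.
rewrite -/w in G1; rewrite -/X -/w in G2.
rewrite /leave_out_weight.
set xx := _ ^+ 2 * (_ / enorm v ^+ 2) in G2 *.
set yy := _ ^+ 2 * (_ / y ^+ 2) in G2 *.
have a0 : 0 <= dot b b by exact: dot_ge0.
have := ler_wpM2l (ltW C0) G2.
have -> : C * (C2 * yy + eta / C * dot b b * w + C2 * dot b b * h `^ (p - 2)) =
  C * C2 * yy + eta * dot b b * w + C * C2 * (dot b b * h `^ (p - 2)).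
  by field; rewrite gt_eqF.
have := ler_wpM2l (mulr_ge0 (ltW eta10) a0) G1.
move=> {}G1 {}G2.
have K0 : 0 <= C * C2 + (1 + eta) * C1 by exact: addr_ge0.
have K1 := ler_wpM2l K0 hD.
have K2 : 0 <= eta * (1 - eta) * (dot b b * w).
  by apply: mulr_ge0; apply: mulr_ge0.
clear -K1 K2 G1 G2; lra.
Qed.

End leave_one_out_vectors.

(** * Measurability, and crude bounds for integrability *)

Section measurability.
Context d (T : measurableType d) (R : realType).

Lemma measurable_dot k (u v : T -> 'cV[R]_k) :
  (forall j, measurable_fun setT (fun w => u w j 0)) ->
  (forall j, measurable_fun setT (fun w => v w j 0)) ->
  measurable_fun setT (fun w => dot (u w) (v w)).
Proof.
by move=> mu mv; apply: measurable_sum => j; exact: measurable_funM.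
Qed.

Lemma measurable_enorm k (u : T -> 'cV[R]_k) :
  (forall j, measurable_fun setT (fun w => u w j 0)) ->
  measurable_fun setT (fun w => enorm (u w)).
Proof.
move=> mu; have ms : measurable_fun setT (Num.sqrt : R -> R).
  by apply: continuous_measurable_fun; exact: sqrt_continuous.
exact: (measurableT_comp ms (measurable_dot mu mu)).
Qed.

Lemma measurable_combine k n (B : 'M[R]_(k, n)) (e : 'I_n -> T -> R) j :
  (forall i, measurable_fun setT (e i)) ->
  measurable_fun setT (fun w => combine B (e^~ w) j 0).
Proof.
move=> me; under eq_fun do rewrite mxE.
by apply: measurable_sum => i; under eq_fun do rewrite mxE; exact: measurable_funM.
Qed.

Lemma measurable_fun_powR (f : T -> R) p :
  measurable_fun setT f -> measurable_fun setT (fun w => f w `^ p).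
Proof. by move=> mf; apply: (measurableT_comp (measurable_powR p)). Qed.

Lemma measurable_excess (f : T -> R) c :
  measurable_fun setT f -> measurable_fun setT (fun w => excess c (f w)).
Proof. by move=> mf; apply: measurable_maxr => //; exact: measurable_funB. Qed.

Lemma measurable_inv (f : T -> R) : measurable_fun setT f ->
  (forall w, 0 <= f w) -> measurable_fun setT (fun w => (f w)^-1).
Proof.
move=> mf f0; rewrite (_ : (fun w => _) = (fun w => f w `^ (- 1))).
  exact: measurable_fun_powR.
by apply/funext => w; rewrite powR_inv1.
Qed.

Lemma measurable_excess_weight (f : T -> R) p c : measurable_fun setT f ->
  measurable_fun setT (fun w => excess_weight p c (f w)).
Proof.
move=> mf; apply: measurable_funM.
  by apply: measurable_fun_powR; exact: measurable_excess.
apply: measurable_inv => [|w]; last exact: sqr_ge0.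
exact: measurable_funX.
Qed.

Lemma measurable_leave_out_weight k p c eta C (b : 'cV[R]_k) (u : T -> 'cV[R]_k) :
  (forall j, measurable_fun setT (fun w => u w j 0)) ->
  measurable_fun setT (fun w => leave_out_weight p c eta C b (u w)).
Proof.
move=> mu; have me := measurable_enorm mu.
have md : measurable_fun setT (fun w => dot b (u w)) by exact: measurable_dot.
apply: measurable_funD.
  by apply: measurable_funM => //; exact: measurable_excess_weight.
apply: measurable_funM => //; apply: measurable_funM; first exact: measurable_funX.
apply: measurable_funM.
  by apply: measurable_fun_powR; exact: measurable_excess.
apply: measurable_inv => [|w]; last exact: sqr_ge0.
exact: measurable_funX.
Qed.

End measurability.

Section norm_of_combination.
Context {R : realType}.

Lemma enorm_combine_le k n (B : 'M[R]_(k, n)) (e : 'I_n -> R) :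
  enorm (combine B e) <= \sum_i `|e i| * enorm (col i B).
Proof.
set y := enorm _; have y0 : 0 <= y by exact: enorm_ge0.
have [->|yn] := eqVneq y 0.
  by apply: sumr_ge0 => i _; rewrite mulr_ge0 ?enorm_ge0.
have yp : 0 < y by rewrite lt_def yn.
rewrite -(ler_pM2r yp) -expr2 sqr_enorm dot_combine mulr_suml.
apply: ler_sum => i _; apply: (le_trans (ler_norm _)).
by rewrite normrM -mulrA ler_wpM2l// dot_le_enorm.
Qed.

Lemma powR_sum_le n (x : 'I_n -> R) p : 0 < p -> (forall i, 0 <= x i) ->
  (\sum_i x i) `^ p <= n%:R `^ p * \sum_i x i `^ p.
Proof.
move=> p0 x0; set S := \sum_i x i `^ p.
have S0 : 0 <= S by apply: sumr_ge0 => i _; exact: powR_ge0.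
have xS i : x i <= S `^ p^-1.
  have -> : x i = (x i `^ p) `^ p^-1 by rewrite -powRrM mulfV ?powRr1// gt_eqF.
  rewrite ge0_ler_powR ?nnegrE ?powR_ge0 ?invr_ge0//; first exact: ltW.
  by rewrite /S (bigD1 i)//= lerDl sumr_ge0// => j _; exact: powR_ge0.
have sS : \sum_i x i <= n%:R * S `^ p^-1.
  apply: (le_trans (ler_sum _ (fun i _ => xS i))).
  by rewrite sumr_const card_ord mulr_natl.
have -> : n%:R `^ p * S = (n%:R * S `^ p^-1) `^ p.
  by rewrite powRM ?powR_ge0// -powRrM mulVf ?powRr1// gt_eqF.
by rewrite ge0_ler_powR ?nnegrE ?mulr_ge0 ?powR_ge0 ?sumr_ge0//; exact: ltW.
Qed.

(** The factor n^p is harmless: the bound only serves to show that the excess moment and the centred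
    terms are integrable. *)
Lemma enorm_combine_powR_le k n (B : 'M[R]_(k, n)) (e : 'I_n -> R) p : 0 < p ->
  enorm (combine B e) `^ p <=
  n%:R `^ p * \sum_i enorm (col i B) `^ p * `|e i| `^ p.
Proof.
move=> p0; apply: (@le_trans _ _ ((\sum_i `|e i| * enorm (col i B)) `^ p)).
  rewrite ge0_ler_powR ?nnegrE ?enorm_ge0 ?enorm_combine_le//; first exact: ltW.
  by apply: sumr_ge0 => i _; rewrite mulr_ge0 ?enorm_ge0.
apply: (le_trans (powR_sum_le p0 _)); first by move=> i; rewrite mulr_ge0 ?enorm_ge0.
by under eq_bigr do rewrite powRM ?enorm_ge0// mulrC.
Qed.

Lemma leave_out_powR_le k n (B : 'M[R]_(k, n)) (e : 'I_n -> R) i p : 0 < p ->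
  \sum_j enorm (col j B) `^ p * `|leave_out i e j| `^ p <=
  \sum_j enorm (col j B) `^ p * `|e j| `^ p.
Proof.
move=> p0; apply: ler_sum => j _; rewrite ler_wpM2l ?powR_ge0// /leave_out.
case: ifP => // _; rewrite normr0 powR0 ?powR_ge0//; by rewrite gt_eqF.
Qed.

End norm_of_combination.

(** * Moment of the excess of a linear combination of the noise *)

Section moments.
Context {R : realType}.

Lemma excess_moment (p th : R) : 2 < p -> 0 < th -> th <= 1 ->
  exists2 C : R, 0 < C &
  forall d (T : measurableType d) (Pr : probability T R) (n k : nat)
    (eps : 'I_n -> {RV Pr >-> R}) (B : 'M[R]_(k, n)) (c r tau : R),
  mutually_independent eps ->
  (forall i, \int[Pr]_w (eps i w)%:E = 0)%E ->
  (forall i, \int[Pr]_w (eps i w ^+ 2)%:E = 1)%E ->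
  (forall i, \int[Pr]_w (`|eps i w| `^ p)%:E = tau%:E)%E ->
  0 < c -> 0 <= r -> 0 <= tau ->
  (forall v, \sum_i dot (col i B) v ^+ 2 <= r * dot v v) ->
  (1 + th) * \sum_i dot (col i B) (col i B) <= c ^+ 2 ->
  (\int[Pr]_w (excess c (enorm (combine B (eps^~ w))) `^ p)%:E <=
   (C * (r `^ (p / 2) + (1 + tau) * \sum_i enorm (col i B) `^ p))%:E)%E.
Proof.
move=> p2 th0 th1; have p0 : 0 < p by lra.
have eta0 : 0 < th / 8 by lra.
have eta1 : th / 8 <= 1 by lra.
have [C1 C10 H1] := leave_out_upper p2 eta0.
have [C2 C20 H2] := leave_out_lower p2 eta0 eta1 C10.
have q0 : 0 < 1 + th by lra.
(* With eta = th / 8 the main term has factor 1 + th / 2, and (1 + th / 2) / (1 + th) = 1 - 2 de.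
   One [de] pays for Young's inequality, the other is what remains on the left after absorption. *)
pose de := th / (4 * (1 + th)).
have de0 : 0 < de by apply: divr_gt0 => //; lra.
have deC : 0 < de / C2 by exact: divr_gt0.
have [C3 C30 H3] := mul_powR_young p2 deC.
have de1 : de <= 1 by rewrite ler_pdivrMr; lra.
exists (de^-1 * (C1 + C2 + C2 * C3)).
  by rewrite mulr_gt0 ?invr_gt0// !addr_gt0// mulr_gt0.
move=> d T Pr n k eps B c r tau indep E1 E2 Ep c0 r0 tau0 hr cT.
pose S := \sum_i enorm (col i B) `^ p.
have S0 : 0 <= S by apply: sumr_ge0 => i _; exact: powR_ge0.
pose Sp w := \sum_i enorm (col i B) `^ p * `|eps i w| `^ p.
have Sp0 w : 0 <= Sp w by apply: sumr_ge0 => i _; rewrite mulr_ge0 ?powR_ge0.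
have meps i : measurable_fun setT (eps i) by exact: measurable_funPT.
have mep i : measurable_fun setT (fun w => `|eps i w| `^ p).
  by apply: measurable_fun_powR; exact: measurableT_comp.
have mepB i : measurable_fun setT (fun w => enorm (col i B) `^ p * `|eps i w| `^ p).
  by apply: measurable_funM.
have mSp : measurable_fun setT Sp by exact: measurable_sum.
have ISp : (\int[Pr]_w (Sp w)%:E = (tau * S)%:E)%E.
  rewrite Int_sum//; last by move=> i w; rewrite mulr_ge0 ?powR_ge0.
  under eq_bigr do rewrite IntZ ?powR_ge0// Ep -EFinM.
  by rewrite sumEFin -mulr_suml mulrC.
pose U w := excess c (enorm (combine B (eps^~ w))) `^ p.
have mU : measurable_fun setT U.
  apply: measurable_fun_powR; apply: measurable_excess; apply: measurable_enorm.
  by move=> j; exact: measurable_combine.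
have U0 w : 0 <= U w by exact: powR_ge0.
have excess_powR_le x : 0 <= x -> excess c x `^ p <= x `^ p.
  move=> x0; rewrite ge0_ler_powR ?nnegrE ?excess_ge0//; first exact: ltW.
  by apply: excess_le => //; exact: ltW.
have US w : U w <= n%:R `^ p * Sp w.
  apply: (le_trans (excess_powR_le _ (enorm_ge0 _))).
  exact: enorm_combine_powR_le.
have IU : (\int[Pr]_w (U w)%:E < +oo)%E.
  apply: (@le_lt_trans _ _ (\int[Pr]_w (n%:R `^ p * Sp w)%:E)%E).
    by apply: le_Int => //; exact: measurable_funM.
  by rewrite IntZ ?powR_ge0// ISp -EFinM ltry.
pose A i w := leave_out_weight p c (th / 8) C1 (col i B) (combine B (leave_out i (eps^~ w))).
pose F i w := dot (col i B) (combine B (leave_out i (eps^~ w))) *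
  excess_weight p c (enorm (combine B (leave_out i (eps^~ w)))).
have mlo i j : measurable_fun (setT : set (g_sigma_algebraType (cylinders eps i)))
    (fun w : g_sigma_algebraType (cylinders eps i) => combine B (leave_out i (eps^~ w)) j 0).
  apply: (@measurable_combine _ (g_sigma_algebraType (cylinders eps i)) R k n B
    (fun l w => leave_out i (eps^~ w) l) j) => l.
  rewrite /leave_out; have [_|li] := eqVneq l i; first exact: measurable_cst.
  exact: measurable_other_coord.
pose Z w := C1 * Sp w.
pose Z' w := C2 * C3 * r `^ (p / 2) + C2 * (S + Sp w).
have IZ : (\int[Pr]_w (Z w)%:E = (C1 * (tau * S))%:E)%E.
  by rewrite IntZ ?ltW// ISp -EFinM.
have mSSp : measurable_fun setT (fun w => S + Sp w) by exact: measurable_funD.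
have cc0 : 0 <= C2 * C3 * r `^ (p / 2) by rewrite mulr_ge0 ?powR_ge0// mulr_ge0// ltW.
have IZ' : (\int[Pr]_w (Z' w)%:E = (C2 * C3 * r `^ (p / 2) + C2 * (S + tau * S))%:E)%E.
  rewrite IntD//; last 2 first.
  - exact: measurable_funM.
  - by move=> w; rewrite mulr_ge0 ?addr_ge0// ltW.
  rewrite Int_cst IntZ//; [|exact: ltW|by move=> w; rewrite addr_ge0].
  by rewrite IntD// Int_cst ISp -!EFinD.
have mlon i : measurable_fun (setT : set (g_sigma_algebraType (cylinders eps i)))
    (fun w : g_sigma_algebraType (cylinders eps i) =>
       enorm (combine B (leave_out i (eps^~ w)))).
  by apply: measurable_enorm => j; exact: mlo.
have mF i : measurable_fun (setT : set (g_sigma_algebraType (cylinders eps i)))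
    (F i : g_sigma_algebraType (cylinders eps i) -> R).
  apply: measurable_funM; first by apply: measurable_dot => j //; exact: mlo.
  by apply: measurable_excess_weight; exact: mlon.
have mA i : measurable_fun (setT : set (g_sigma_algebraType (cylinders eps i)))
    (A i : g_sigma_algebraType (cylinders eps i) -> R).
  by apply: measurable_leave_out_weight => j; exact: mlo.
have FS i w : `|F i w| <= enorm (col i B) * (1 + n%:R `^ p * Sp w).
  rewrite /F normrM (ger0_norm (excess_weight_ge0 _ _ _)).
  set v := combine B _; have v0 := enorm_ge0 v.
  apply: (@le_trans _ _ (enorm (col i B) * (enorm v * excess_weight p c (enorm v)))).
    by rewrite mulrA ler_wpM2r ?excess_weight_ge0// dot_le_enorm.
  rewrite ler_wpM2l ?enorm_ge0//; apply: (le_trans (mul_excess_weight_le p2 c0 v0)).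
  have vS : enorm v `^ p <= n%:R `^ p * Sp w.
    apply: (le_trans (enorm_combine_powR_le _ _ p0)).
    by rewrite ler_wpM2l ?powR_ge0// leave_out_powR_le.
  apply: (@le_trans _ _ (1 + excess c (enorm v) `^ p)); last first.
    by rewrite lerD2l; exact: le_trans (excess_powR_le _ v0) vS.
  by apply: powR_le1D => //; [exact: excess_ge0|lra|lra].
have IF i : (\int[Pr]_w (`|F i w|)%:E < +oo)%E.
  have m1 : measurable_fun setT (fun w => 1 + n%:R `^ p * Sp w).
    by apply: measurable_funD => //; exact: measurable_funM.
  have m0 w : 0 <= 1 + n%:R `^ p * Sp w by rewrite addr_ge0// mulr_ge0 ?powR_ge0.
  apply: (@le_lt_trans _ _ (\int[Pr]_w (enorm (col i B) * (1 + n%:R `^ p * Sp w))%:E)%E).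
    apply: le_Int => //; last exact: measurable_funM.
    apply: measurableT_comp => //; apply: measurable_fun_other_coords; exact: mF.
  rewrite IntZ ?enorm_ge0// IntD//; last 2 first.
  - exact: measurable_funM.
  - by move=> w; rewrite mulr_ge0 ?powR_ge0.
  by rewrite Int_cst IntZ ?powR_ge0// ISp -EFinM ltry.
have E1' i : (\int[Pr]_w (`|eps i w|)%:E < +oo)%E.
  apply: (@le_lt_trans _ _ (\int[Pr]_w (1 + `|eps i w| `^ p)%:E)%E).
    apply: le_Int => //; first exact: measurableT_comp.
      exact: measurable_funD.
    by move=> w; rewrite -[leLHS]powRr1//; apply: powR_le1D => //; lra.
  rewrite IntD//.
  by rewrite (Int_cst Pr 1) Ep ltry.
have UA w : U w <= \sum_i (eps i w ^+ 2 * A i w + eps i w * F i w) + Z w.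
  exact: H1.
have AU w : \sum_i A i w <= (1 - de) * U w + Z' w.
  apply: (le_trans (H2 _ _ _ B (eps^~ w) _ c0 r0 hr)).
  set x := enorm _; set ew := excess_weight p c x.
  have x0 : 0 <= x by exact: enorm_ge0.
  have ew0 : 0 <= ew by exact: excess_weight_ge0.
  (* The threshold enters here: below [c] the weight vanishes, and above it x^2 >= c^2 >= (1 + th)
     t. *)
  have Tw : (1 + th) * ((\sum_i dot (col i B) (col i B)) * ew) <= U w.
    rewrite mulrA /U -/x -mul_excess_weight//.
    have [xc|/ltW cx] := leP x c.
      by rewrite /ew excess_weight_eq0// !mulr0.
    rewrite ler_wpM2r//; apply: (le_trans cT).
    by rewrite lerXn2r ?nnegrE// ltW.
  have Y := ler_wpM2l (ltW C20) (H3 _ _ r0 (excess_ge0 c x)).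
  have YE : C2 * (de / C2 * excess c x `^ p + C3 * r `^ (p / 2)) =
      de * U w + C2 * C3 * r `^ (p / 2).
    by rewrite /U -/x; field; rewrite gt_eqF.
  rewrite YE in Y.
  have -> : \sum_i enorm (col i B) `^ p * (1 + `|eps i w| `^ p) = S + Sp w.
    by rewrite -big_split/=; apply: eq_bigr => i _; rewrite mulrDr mulr1.
  have Tw' : (1 + 4 * (th / 8)) * ((\sum_i dot (col i B) (col i B)) * ew) <=
      (1 - de - de) * U w.
    have -> : 1 - de - de = (1 + th / 2) / (1 + th).
      by rewrite /de; field; rewrite gt_eqF.
    rewrite mulrAC ler_pdivlMr//.
    have := ler_wpM2l (_ : 0 <= 1 + th / 2) Tw; move=> /(_ (ltac:(lra))).
    lra.
  rewrite /Z'; clear -Y Tw'; lra.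
have Z0 w : 0 <= Z w by rewrite mulr_ge0// ltW.
have Z'0 w : 0 <= Z' w by rewrite addr_ge0// mulr_ge0 ?addr_ge0// ltW.
have mZ : measurable_fun setT Z by exact: measurable_funM.
have mZ' : measurable_fun setT Z' by apply: measurable_funD => //; exact: measurable_funM.
have A0 i w : 0 <= A i w.
  apply: addr_ge0.
    by rewrite mulr_ge0 ?excess_weight_ge0// mulr_ge0 ?dot_ge0//; lra.
  apply: mulr_ge0; first exact: ltW.
  apply: mulr_ge0; first exact: sqr_ge0.
  by apply: divr_ge0; [exact: powR_ge0|exact: sqr_ge0].
have de2 : 0 <= 1 - de by lra.
have de3 : 1 - de <= 1 by lra.
have := leave_one_out_bound indep E1 E2 E1' mA A0 mF IF mU U0 IU mZ Z0 mZ' Z'0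
  de2 de3 UA AU.
rewrite IZ IZ' -EFinD.
have Ufin : (\int[Pr]_w (U w)%:E)%E \is a fin_num by rewrite ge0_fin_numE ?Int_ge0.
rewrite -[X in (X <= _)%E -> _]/(_ * \int[Pr]_w (U w)%:E)%E.
rewrite -[X in _ -> (X <= _)%E]/(\int[Pr]_w (U w)%:E)%E.
rewrite -(fineK Ufin) -EFinM !lee_fin -/S.
have -> : 1 - (1 - de) = de by lra.
move=> H; rewrite -mulrA mulrC ler_pdivlMr// mulrC; apply: (le_trans H).
set RR := r `^ _; have RR0 : 0 <= RR by exact: powR_ge0.
have tS : 0 <= tau * S by exact: mulr_ge0.
have : 0 <= C1 * S by rewrite mulr_ge0// ltW.
have : 0 <= C1 * RR by rewrite mulr_ge0// ltW.
have : 0 <= C2 * RR by rewrite mulr_ge0// ltW.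
have : 0 <= C2 * C3 * (S + tau * S).
  by apply: mulr_ge0; [apply: mulr_ge0; exact: ltW|exact: addr_ge0].
clear; lra.
Qed.

End moments.

(** * Spectral norm and orthogonal projections *)

Section spectral.
Context {R : realType}.

Lemma dot_mulmx k n (A : 'M[R]_(k, n)) x y : dot (A *m x) y = dot x (A^T *m y).
Proof.
rewrite /dot; under eq_bigr do rewrite mxE mulr_suml.
under [RHS]eq_bigr do rewrite mxE mulr_sumr.
rewrite exchange_big; apply: eq_bigr => j _; apply: eq_bigr => i _ /=.
by rewrite mxE mulrAC mulrC mulrA (mulrC (x j 0)).
Qed.

Lemma combineE k n (A : 'M[R]_(k, n)) x : A *m x = combine A (fun i => x i 0).
Proof. by rewrite /combine; congr (_ *m _); apply/colP => i; rewrite mxE. Qed.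

Lemma sum_sqr_dot_col k n (A : 'M[R]_(k, n)) v :
  \sum_i dot (col i A) v ^+ 2 = dot (A^T *m v) (A^T *m v).
Proof.
apply: eq_bigr => i _; rewrite expr2; congr (_ * _); rewrite mxE;
  by apply: eq_bigr => j _; rewrite !mxE.
Qed.

Lemma sum_dot_col k n (A : 'M[R]_(k, n)) :
  \sum_i dot (col i A) (col i A) = \tr (A^T *m A).
Proof.
by apply: eq_bigr => i _; rewrite mxE; apply: eq_bigr => j _; rewrite !mxE.
Qed.

Lemma sum_dot_col_gt0 k n (A : 'M[R]_(k, n)) (x : 'cV[R]_n) : A *m x != 0 ->
  0 < \sum_i dot (col i A) (col i A).
Proof.
move=> Ax; rewrite lt_def sumr_ge0 ?andbT => [|i _]; last exact: dot_ge0.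
apply: contraNneq Ax => /eqP; rewrite psumr_eq0 => [/allP h|i _]; last exact: dot_ge0.
rewrite (_ : A = 0) ?mul0mx//; apply/matrixP => j i.
have := h i (mem_index_enum i); rewrite dot_sqr_eq0 => /eqP/colP/(_ j).
by rewrite !mxE.
Qed.

Context {n : nat}.
Implicit Types (x y u v : 'cV[R]_n) (A : 'M[R]_n).

Lemma norm_nE x : norm_n x = Num.sqrt n%:R^-1 * enorm x.
Proof. by rewrite /norm_n sqrtrM ?invr_ge0. Qed.

Lemma sqr_norm_n x : norm_n x ^+ 2 = n%:R^-1 * dot x x.
Proof. by rewrite norm_nE exprMn sqr_enorm sqr_sqrtr ?invr_ge0. Qed.

Lemma norm_n_ge0 x : 0 <= norm_n x.
Proof. exact: sqrtr_ge0. Qed.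

Hypothesis n0 : (0 < n)%N.

Let n0R : 0 < n%:R :> R. Proof. by rewrite ltr0n. Qed.

Lemma spectral_ratioE A x : norm_n (A *m x) / norm_n x = enorm (A *m x) / enorm x.
Proof.
have s0 : Num.sqrt (n%:R^-1 : R) != 0 by rewrite sqrtr_eq0 -ltNge invr_gt0.
by rewrite !norm_nE invfM mulrACA divff// mul1r.
Qed.

Lemma enorm_eq0 x : (enorm x == 0) = (x == 0).
Proof. by rewrite -dot_sqr_eq0 -sqr_enorm sqrf_eq0. Qed.

(** Makes the real [sup] meaningful: n > 0 supplies a nonzero vector, and the sum of the column
    norms is an upper bound. *)
Lemma spectral_has_sup A :
  has_sup [set norm_n (A *m x) / norm_n x | x in [set x | x != 0]].
Proof.
split.
  pose x : 'cV[R]_n := const_mx 1.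
  exists (norm_n (A *m x) / norm_n x); exists x => //=.
  apply/eqP => /colP/(_ (Ordinal n0)); rewrite !mxE => /eqP.
  by rewrite oner_eq0.
exists (\sum_i enorm (col i A)) => _ [x /= x0 <-].
rewrite spectral_ratioE ler_pdivrMr; last by rewrite lt_def enorm_ge0 enorm_eq0 x0.
rewrite combineE; apply: (le_trans (enorm_combine_le _ _)).
rewrite mulr_suml; apply: ler_sum => i _; rewrite mulrC ler_wpM2l ?enorm_ge0//.
rewrite -(@ler_pXn2r _ 2)// ?nnegrE ?enorm_ge0// real_normK ?num_real// sqr_enorm.
by rewrite /dot (bigD1 i)//= -expr2 lerDl sumr_ge0// => j _; rewrite -expr2 sqr_ge0.
Qed.

Lemma enorm_mulmx_le A x : enorm (A *m x) <= spectral_norm A * enorm x.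
Proof.
have [->|x0] := eqVneq x 0.
  by rewrite mulmx0 /enorm dot0 sqrtr0 mulr0.
rewrite -ler_pdivrMr; last by rewrite lt_def enorm_ge0 enorm_eq0 x0.
rewrite -spectral_ratioE; apply: (ub_le_sup (spectral_has_sup A).2).
by exists x.
Qed.

Lemma spectral_norm_ge0 A : 0 <= spectral_norm A.
Proof.
have [[_ [x /= x0 _]] hub] := spectral_has_sup A.
apply: (@le_trans _ _ (norm_n (A *m x) / norm_n x)).
  by rewrite divr_ge0 ?norm_n_ge0.
by apply: ub_le_sup => //; exists x.
Qed.

Lemma spectral_norm_le A (K : R) : (forall x, enorm (A *m x) <= K * enorm x) ->
  spectral_norm A <= K.
Proof.
move=> h; apply: ge_sup; first exact: (spectral_has_sup A).1.
move=> _ [x /= x0 <-]; rewrite spectral_ratioE ler_pdivrMr//.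
by rewrite lt_def enorm_ge0 enorm_eq0 x0.
Qed.

Lemma spectral_norm_gt0 A x : A *m x != 0 -> 0 < spectral_norm A.
Proof.
move=> Ax; rewrite lt_def spectral_norm_ge0 andbT.
apply: contraNneq Ax => A0; have := enorm_mulmx_le A x.
by rewrite A0 mul0r -enorm_eq0 eq_le enorm_ge0 andbT.
Qed.

(** With y = A^T v one has <y, y> = <A y, v>, then Cauchy-Schwarz. This provides the operator
    hypothesis of the moment bounds with [r] the squared spectral norm. *)
Lemma dot_trmx_mulmx_le A v :
  dot (A^T *m v) (A^T *m v) <= spectral_norm A ^+ 2 * dot v v.
Proof.
set y := A^T *m v; have y0 := enorm_ge0 y.
rewrite -!sqr_enorm -exprMn.
rewrite lerXn2r ?nnegrE ?mulr_ge0 ?enorm_ge0 ?spectral_norm_ge0//.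
have [->|yn] := eqVneq (enorm y) 0.
  by rewrite mulr_ge0 ?enorm_ge0 ?spectral_norm_ge0.
have yp : 0 < enorm y by rewrite lt_def yn.
rewrite -(ler_pM2r yp) -expr2 sqr_enorm -{1}/y.
have -> : dot y y = dot (A *m y) v by rewrite dot_mulmx.
apply: (le_trans (ler_norm _)); apply: (le_trans (dot_le_enorm _ _)).
by rewrite mulrC mulrAC (mulrC (spectral_norm A * _)) ler_wpM2l ?enorm_ge0// enorm_mulmx_le.
Qed.

End spectral.

Section projection.
Context {R : realType} {n : nat}.
Implicit Types (x y u v : 'cV[R]_n) (U : {vspace 'cV[R]_n}).
Hypothesis n0 : (0 < n)%N.

Lemma inner_n_eq0 x y : inner_n x y = 0 -> dot x y = 0.
Proof.
rewrite /inner_n => /eqP; rewrite mulf_eq0 invr_eq0 pnatr_eq0 -leqn0 leqNgt n0/=.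
by move/eqP.
Qed.

Lemma orthoproj_dot U x u : u \in U -> dot x u = dot (orthoproj U *m x) u.
Proof.
move=> uU; have /(_ u uU) := (orthoprojP U x).2; move/inner_n_eq0.
by rewrite dotBl => /eqP; rewrite subr_eq0 => /eqP.
Qed.

Lemma orthoproj_mem U x : orthoproj U *m x \in U.
Proof. exact: (orthoprojP U x).1. Qed.

Lemma orthoproj_dotr U x y :
  dot x (orthoproj U *m y) = dot (orthoproj U *m x) (orthoproj U *m y).
Proof. by rewrite (@orthoproj_dot U)// orthoproj_mem. Qed.

Lemma orthoproj_id U u : u \in U -> orthoproj U *m u = u.
Proof.
move=> uU; apply/eqP; rewrite -subr_eq0 -dot_sqr_eq0.
have dU : orthoproj U *m u - u \in U by rewrite rpredB// orthoproj_mem.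
by rewrite dotBl (orthoproj_dot u dU) subrr.
Qed.

Lemma orthoproj_pythagoras U x :
  dot x x = dot (x - orthoproj U *m x) (x - orthoproj U *m x)
    + dot (orthoproj U *m x) (orthoproj U *m x).
Proof.
set y := orthoproj U *m x.
have E : dot x y = dot y y by rewrite /y orthoproj_dotr.
by rewrite dotBl !(dotC _ (x - y)) !dotBl (dotC y x) E subrr subr0 subrK.
Qed.

Lemma enorm_orthoproj_le U x : enorm (orthoproj U *m x) <= enorm x.
Proof.
rewrite -(@ler_pXn2r _ 2)// ?nnegrE ?enorm_ge0// !sqr_enorm.
by rewrite [leRHS](orthoproj_pythagoras U) lerDr dot_ge0.
Qed.

(** The identity pi = pi^T pi, read entry by entry from [orthoproj_dotr]; it turns the trace of the
    penalty into the sum of squared column norms of pi P. *)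
Lemma tr_orthoproj U k (P : 'M[R]_(n, k)) :
  \tr (P^T *m orthoproj U *m P) =
  \tr ((orthoproj U *m P)^T *m (orthoproj U *m P)).
Proof.
suff E : orthoproj U = (orthoproj U)^T *m orthoproj U.
  by rewrite trmx_mul {1}E !mulmxA.
apply/matrixP => i j.
have entry (A : 'M[R]_n) : A i j = dot (delta_mx i 0) (A *m delta_mx j 0).
  rewrite -colE /dot (bigD1 i)//= !mxE !eqxx mul1r big1 ?addr0// => l li.
  by rewrite !mxE (negbTE li) mul0r.
rewrite !entry orthoproj_dotr dot_mulmx mulmxA; congr dot.
Qed.

End projection.

(** * Moment bounds for standardized noise *)

Section standard_noise.
Context {R : realType}.

Definition standard_noise d (T : measurableType d) (Pr : probability T R) n
    (eps : 'I_n -> {RV Pr >-> R}) (p tau : R) :=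
  [/\ mutually_independent eps,
      (forall i, \int[Pr]_w (eps i w)%:E = 0)%E,
      (forall i, \int[Pr]_w (eps i w ^+ 2)%:E = 1)%E &
      (forall i, \int[Pr]_w (`|eps i w| `^ p)%:E = tau%:E)%E].

Lemma powR_tangent (x s : R) : 1 < s -> 0 <= x -> s * x <= x `^ s + (s - 1).
Proof.
move=> s1 x0; have [x1|x1] := leP x 1.
  by have := powR_convex_diff s1 x0 x1; rewrite !powR1; lra.
have s0 : 0 < s by lra.
have q0 : 0 < s / (s - 1) by rewrite divr_gt0//; lra.
have pq : s^-1 + (s / (s - 1))^-1 = 1 by rewrite invf_div; field; rewrite gt_eqF.
have := @conjugate_powR _ x 1 s (s / (s - 1)) x0 ler01 s0 q0 pq.
rewrite powR1 mulr1 invf_div mul1r => h.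
have := ler_wpM2l (ltW s0) h.
have -> : s * (x `^ s / s + (s - 1) / s) = x `^ s + (s - 1).
  by field; rewrite gt_eqF.
by [].
Qed.

(** Jensen in elementary form: the tangent at 1 of the power p/2, applied to eps_i^2 and integrated.
    It lets terms without [tau] be charged to [tau]. *)
Lemma noise_moment_ge1 d (T : measurableType d) (Pr : probability T R) n
    (eps : 'I_n -> {RV Pr >-> R}) (p tau : R) : (0 < n)%N -> 2 < p ->
  standard_noise eps p tau -> 1 <= tau.
Proof.
move=> n0 p2 [_ _ E2 Ep]; pose i := Ordinal n0.
have meps : measurable_fun setT (eps i) by exact: measurable_funPT.
have mp : measurable_fun setT (fun w => `|eps i w| `^ p).
  by apply: measurable_fun_powR; exact: measurableT_comp.
have s1 : 1 < p / 2 by lra.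
have : (\int[Pr]_w ((p / 2) * eps i w ^+ 2)%:E <=
        \int[Pr]_w (`|eps i w| `^ p + (p / 2 - 1))%:E)%E.
  apply: le_Int.
  - by apply: measurable_funM => //; exact: measurable_funX.
  - exact: measurable_funD.
  - by move=> w; rewrite mulr_ge0 ?sqr_ge0//; lra.
  move=> w; rewrite -(powR_half_sqr p (normr_ge0 (eps i w))).
  by rewrite real_normK ?num_real//; apply: powR_tangent => //; exact: sqr_ge0.
rewrite IntZ; [|lra|exact: measurable_funX|by move=> w; exact: sqr_ge0].
rewrite IntD//; last by move=> w; lra.
by rewrite Int_cst E2 Ep -EFinD mule1 lee_fin; lra.
Qed.

(** The trade of moments: the excess is nonzero only where x > b, and there x^(q-s) <= b^(q-s) since
    q <= s. *)
Lemma excess_powR_le (b x q s : R) : 0 < b -> 0 <= x -> 0 < q -> q <= s ->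
  excess b x `^ q <= x `^ s * b `^ (q - s).
Proof.
move=> b0 x0 q0 qs; have [xb|bx] := leP x b.
  by rewrite excess_eq0// powR0 ?mulr_ge0 ?powR_ge0// gt_eqF.
have xp : 0 < x by lra.
apply: (@le_trans _ _ (x `^ q)).
  by rewrite ge0_ler_powR ?nnegrE ?excess_ge0 ?excess_le// ltW.
have -> : x `^ q = x `^ s * x `^ (q - s).
  by rewrite -powRD ?(addrC s) ?subrK//; apply/implyP => _; rewrite gt_eqF.
rewrite ler_wpM2l ?powR_ge0//.
have -> : q - s = - (s - q) by lra.
rewrite !powRN lef_pV2 ?posrE ?powR_gt0//.
by rewrite ge0_ler_powR ?nnegrE//; lra.
Qed.

Lemma powRD_le (x y q : R) : 0 < q -> 0 <= x -> 0 <= y ->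
  (x + y) `^ q <= 2 `^ q * (x `^ q + y `^ q).
Proof.
move=> q0 x0 y0.
wlog xy : x y x0 y0 / x <= y.
  move=> h; have [xy|/ltW yx] := leP x y; first exact: h.
  by rewrite addrC [X in _ * X]addrC; exact: h.
apply: (@le_trans _ _ ((2 * y) `^ q)).
  by rewrite ge0_ler_powR ?nnegrE//; lra.
by rewrite powRM// ler_wpM2l ?powR_ge0// lerDr powR_ge0.
Qed.

(** The sum of the |b_i|^p is at most r^(p/2 - 1) t because every |b_i|^2 is at most [r]; hence the
    factor 1 + t / r. *)
Lemma excess_moment_operator (p th : R) : 2 < p -> 0 < th -> th <= 1 ->
  exists2 C : R, 0 < C &
  forall d (T : measurableType d) (Pr : probability T R) (n k : nat)
    (eps : 'I_n -> {RV Pr >-> R}) (B : 'M[R]_(k, n)) (c r tau : R),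
  (0 < n)%N -> standard_noise eps p tau -> 0 < c -> 0 < r ->
  (forall v, \sum_i dot (col i B) v ^+ 2 <= r * dot v v) ->
  (1 + th) * \sum_i dot (col i B) (col i B) <= c ^+ 2 ->
  (\int[Pr]_w (excess c (enorm (combine B (eps^~ w))) `^ p)%:E <=
   (C * tau * r `^ (p / 2) *
     (1 + (\sum_i dot (col i B) (col i B)) / r))%:E)%E.
Proof.
move=> p2 th0 th1; have [C C0 HC] := excess_moment p2 th0 th1.
exists (2 * C); first by rewrite mulr_gt0.
move=> d T Pr n k eps B c r tau n0 noise c0 r0 hr cT.
have tau1 := noise_moment_ge1 n0 p2 noise.
have [indep E1 E2 Ep] := noise.
have tau0 : 0 <= tau by lra.
apply: (le_trans (HC _ _ _ _ _ _ _ _ _ _ indep E1 E2 Ep c0 (ltW r0) tau0 hr cT)).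
rewrite lee_fin.
set TT := \sum_i dot _ _; set rp := r `^ (p / 2).
have rp0 : 0 <= rp by exact: powR_ge0.
have SS : \sum_i enorm (col i B) `^ p <= rp * (TT / r).
  rewrite mulrCA /TT mulr_suml; apply: ler_sum => i _.
  (* The operator bound tested at the column itself, keeping only its own term. *)
  have ai : dot (col i B) (col i B) <= r.
    have [->|a0] := eqVneq (dot (col i B) (col i B)) 0; first exact: ltW.
    have ap : 0 < dot (col i B) (col i B) by rewrite lt_def a0 dot_ge0.
    rewrite -(ler_pM2r ap); apply: le_trans (hr (col i B)).
    rewrite -expr2 (bigD1 i)//= lerDl sumr_ge0// => j _; exact: sqr_ge0.
  rewrite -powR_half_sqr ?enorm_ge0// sqr_enorm.
  have p1 : 1 < p / 2 by lra.
  rewrite powR_sub1 ?dot_ge0// mulrC ler_wpM2l ?dot_ge0//.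
  rewrite /rp (powR_sub1 p1 (ltW r0)) mulfK ?gt_eqF//.
  by rewrite ge0_ler_powR ?nnegrE ?dot_ge0 ?(ltW r0)//; lra.
have TT0 : 0 <= TT / r.
  by apply: divr_ge0; [apply: sumr_ge0 => i _; exact: dot_ge0|exact: ltW].
have X0 : 0 <= rp * (TT / r) by exact: mulr_ge0.
rewrite -!mulrA [leRHS]mulrCA ler_pM2l//.
have := ler_wpM2l (_ : 0 <= 1 + tau) SS; move=> /(_ (ltac:(lra))).
have : 0 <= (tau - 1) * rp by apply: mulr_ge0; lra.
have : 0 <= (tau - 1) * (rp * (TT / r)) by apply: mulr_ge0; lra.
have : 0 <= tau * rp by apply: mulr_ge0; lra.
clear; lra.
Qed.

(** The previous bound for the one-row matrix v^T, at level 2 rho, whose square exceeds 2 |v|^2. The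
    absolute value is at most 4 rho or at most twice its excess. *)
Lemma linear_moment (p : R) : 2 < p ->
  exists2 C : R, 0 < C &
  forall d (T : measurableType d) (Pr : probability T R) (n : nat)
    (eps : 'I_n -> {RV Pr >-> R}) (v : 'cV[R]_n) (rho tau : R),
  (0 < n)%N -> standard_noise eps p tau -> 0 < rho -> dot v v <= rho ^+ 2 ->
  (\int[Pr]_w (`|\sum_i v i 0 * eps i w| `^ p)%:E <=
   (C * tau * rho `^ p)%:E)%E.
Proof.
move=> p2; have [C C0 HC] := excess_moment_operator p2 ltr01 (lexx 1).
exists (4 `^ p + 2 `^ p * (2 * C)).
  by rewrite addr_gt0 ?powR_gt0// mulr_gt0 ?powR_gt0// mulr_gt0.
move=> d T Pr n eps v rho tau n0 noise rho0 vr.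
have tau1 := noise_moment_ge1 n0 p2 noise.
pose B : 'M[R]_(1, n) := v^T.
have dotB i (x : 'cV[R]_1) : dot (col i B) x = v i 0 * x 0 0.
  by rewrite /dot big_ord1 !mxE.
have dot1 (x : 'cV[R]_1) : dot x x = x 0 0 ^+ 2 by rewrite /dot big_ord1 -expr2.
have BT : \sum_i dot (col i B) (col i B) = dot v v.
  by apply: eq_bigr => i _; rewrite dotB !mxE.
have Br x : \sum_i dot (col i B) x ^+ 2 <= rho ^+ 2 * dot x x.
  under eq_bigr do rewrite dotB exprMn.
  by rewrite -mulr_suml -(dot1 x) ler_wpM2r ?dot_ge0.
have rr0 : 0 < rho ^+ 2 by exact: exprn_gt0.
have c0 : 0 < 2 * rho by rewrite mulr_gt0.
have cT : (1 + 1) * \sum_i dot (col i B) (col i B) <= (2 * rho) ^+ 2.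
  by rewrite BT exprMn; nra.
have := HC _ _ _ _ _ _ B _ _ _ n0 noise c0 rr0 Br cT.
rewrite BT powR_half_sqr ?(ltW rho0)// => HB.
have meps i : measurable_fun setT (eps i) by exact: measurable_funPT.
have EN w : enorm (combine B (eps^~ w)) = `|\sum_i v i 0 * eps i w|.
  rewrite /enorm dot1 sqrtr_sqr; congr `|_|; rewrite mxE.
  by apply: eq_bigr => i _; rewrite !mxE.
have mN : measurable_fun setT (fun w => enorm (combine B (eps^~ w))).
  by apply: measurable_enorm => j; exact: measurable_combine.
have mX : measurable_fun setT (fun w => excess (2 * rho) (enorm (combine B (eps^~ w))) `^ p).
  by apply: measurable_fun_powR; exact: measurable_excess.
under eq_integral do rewrite -EN.
have K0 : 0 <= 2 `^ p :> R by exact: powR_ge0.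
apply: (@le_trans _ _ (\int[Pr]_w ((4 * rho) `^ p +
    2 `^ p * excess (2 * rho) (enorm (combine B (eps^~ w))) `^ p)%:E)%E).
  apply: le_Int.
    exact: measurable_fun_powR.
    by apply: measurable_funD => //; exact: measurable_funM.
    by move=> w; exact: powR_ge0.
  move=> w; set y := enorm _; have y0 : 0 <= y by exact: enorm_ge0.
  have X0 := excess_ge0 (2 * rho) y.
  have yX : y <= 2 * rho + excess (2 * rho) y.
    have : y - 2 * rho <= excess (2 * rho) y by rewrite le_max lexx.
    lra.
  have [h|h] := leP (excess (2 * rho) y) (2 * rho).
    apply: (@le_trans _ _ ((4 * rho) `^ p)).
      by rewrite ge0_ler_powR ?nnegrE//; lra.
    by rewrite lerDl mulr_ge0 ?powR_ge0.
  apply: (@le_trans _ _ (2 `^ p * excess (2 * rho) y `^ p)).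
    by rewrite -powRM// ge0_ler_powR ?nnegrE ?mulr_ge0//; lra.
  by rewrite lerDr powR_ge0.
rewrite IntD//; last 3 first.
- exact: measurable_funM.
- by move=> _; exact: powR_ge0.
- by move=> w; rewrite mulr_ge0 ?powR_ge0.
rewrite Int_cst IntZ//; last by move=> w; exact: powR_ge0.
apply: (@le_trans _ _ (((4 * rho) `^ p)%:E + (2 `^ p)%:E *
    (C * tau * rho `^ p * (1 + dot v v / rho ^+ 2))%:E)%E).
  by apply: leeD => //; apply: lee_wpmul2l.
rewrite -EFinM -EFinD lee_fin powRM ?(ltW rho0)//.
have vr1 : dot v v / rho ^+ 2 <= 1 by rewrite ler_pdivrMr// mul1r.
have M0 : 0 <= 2 `^ p * (C * tau * rho `^ p).
  by rewrite mulr_ge0// mulr_ge0 ?powR_ge0// mulr_ge0//; lra.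
have := ler_wpM2l M0 vr1.
have : 0 <= 4 `^ p * rho `^ p * (tau - 1).
  by apply: mulr_ge0; [rewrite mulr_ge0 ?powR_ge0|lra].
clear; lra.
Qed.

End standard_noise.

(** * Deviations of one model and the oracle inequality *)

Section countable_sup.
Context d (T : measurableType d) (R : realType) (Pr : probability T R).

Lemma esum_one_le_counting (M : choiceType) (A : set M) :
  (\esum_(i in A) (1 : \bar R) <= @counting M R A)%E.
Proof.
rewrite /counting; case: asboolP => fA; last by rewrite leey.
rewrite esum_fset// fsbig_finite//= big_const_seq count_predT.
elim: (size _) => [//|k IH] /=.
by rewrite -natr1 EFinD [leRHS]addeC; exact: leeD2l.
Qed.

(** [mhat] is not known to be measurable, so f (mhat w) w is never integrated: the measurable
    minorant [g] is compared with the sum of all the [f m]. *)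
Lemma integral_random_index_le (M : countType) (f : M -> T -> R) (K : R)
    (t : M -> R) (g : T -> R) (mhat : T -> M) :
  (forall m, measurable_fun setT (f m)) -> (forall m w, 0 <= f m w) ->
  measurable_fun setT g -> (forall w, 0 <= g w) ->
  (forall w, g w <= f (mhat w) w) ->
  0 <= K -> (forall m, 0 <= t m) ->
  (forall m, \int[Pr]_w (f m w)%:E <= (K * t m)%:E)%E ->
  (\int[Pr]_w (g w)%:E <= K%:E * \esum_(m in [set: M]) (t m)%:E)%E.
Proof.
move=> mf f0 mg g0 gf K0 t0 ft.
(* Models are enumerated by their codes; a natural number that codes no model contributes 0. *)
pose F n w : R := if pickle_inv n is Some m then f m w else 0.
pose tt n : R := if pickle_inv n is Some m then t m else 0.
have F0 n w : 0 <= F n w by rewrite /F; case: pickle_inv.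
have tt0 n : 0 <= tt n by rewrite /tt; case: pickle_inv.
have mF n : measurable_fun setT (F n).
  by rewrite /F; case: pickle_inv => [m|]; [exact: mf|exact: measurable_cst].
have gF w : ((g w)%:E <= \sum_(n <oo) (F n w)%:E)%E.
  set k := @pickle M (mhat w).
  apply: (@le_trans _ _ (F k w)%:E).
    by rewrite lee_fin /F /k pickleK_inv.
  apply: (@le_trans _ _ (\sum_(0 <= n < k.+1) (F n w)%:E)%E).
    by rewrite big_nat_recr//= leeDr// sume_ge0// => n _; rewrite lee_fin.
  by apply: nneseries_lim_ge => n _ _; rewrite lee_fin.
apply: (@le_trans _ _ (\int[Pr]_w (\sum_(n <oo) (F n w)%:E))%E).
  apply: ge0_le_integral => //.
  - by move=> w _; rewrite lee_fin.
  - exact/measurable_EFinP.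
  - apply: ge0_emeasurable_sum => [n w _ _|n _]; first by rewrite lee_fin.
    exact/measurable_EFinP.
rewrite integral_nneseries//; last 2 first.
- by move=> n; exact/measurable_EFinP.
- by move=> n w _; rewrite lee_fin.
apply: (@le_trans _ _ (\sum_(n <oo) K%:E * (tt n)%:E)%E).
  apply: lee_nneseries => [n _ _|n _].
    by apply: integral_ge0 => w _; rewrite lee_fin.
  rewrite /F /tt; case: pickle_inv => [m|]; first by rewrite -EFinM.
  by rewrite Int_cst mule0.
rewrite nneseriesZl; last by move=> n _; rewrite lee_fin.
apply: lee_wpmul2l => //.
rewrite nneseries_esumT; last by move=> n; rewrite lee_fin.
rewrite (esumID (range (@pickle M))); last by move=> n _; rewrite lee_fin.
rewrite !setTI [X in (_ + X)%E]esum1 ?adde0; last first.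
  move=> n /= nM; rewrite /tt; case E : pickle_inv => [m|]//.
  exfalso; apply: nM; exists m => //.
  by have := @pickle_invK M n; rewrite /ocancel E.
rewrite esum_image; last by move=> x y _ _; exact: (pcan_inj pickleK_inv).
by apply: le_esum => m _; rewrite /tt pickleK_inv.
Qed.

End countable_sup.

Section deviation.
Context {R : realType}.

(** Three factors 1 + slack must fit under 1 + th: one multiplies the quadratic form in [deviation],
    one separates c^2 from t, one comes from expanding a square. The 7 is 3 + 3 + 1, the
    coefficients of the cube. *)
Definition slack (th : R) := Num.min 1 th / 7.

Lemma slackP th : 0 < th ->
  [/\ 0 < slack th, slack th <= 7^-1 & (1 + slack th) ^+ 3 <= 1 + th].
Proof.
move=> th0; have m0 : 0 < Num.min 1 th by rewrite lt_min ltr01.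
have m1 : Num.min 1 th <= 1 by rewrite ge_min lexx.
have m2 : Num.min 1 th <= th by rewrite ge_min lexx orbT.
rewrite /slack; set m := Num.min 1 th in m0 m1 m2 *.
split; [lra|lra|].
have -> : (1 + m / 7) ^+ 3 = 1 + 3 * (m / 7) + 3 * (m / 7) ^+ 2 + (m / 7) ^+ 3 by ring.
have h : 0 <= m / 7 <= 1 by apply/andP; split; lra.
move/andP: h => [h0 h1].
have : (m / 7) ^+ 2 <= m / 7 by rewrite expr2; nra.
have : (m / 7) ^+ 3 <= m / 7 by rewrite exprS; nra.
lra.
Qed.

(* [A] is pi_m P, [t] is Tr(tP pi_m P), [u] is the direction of s - s_m and
   [e] is the noise eps. *)
Definition deviation n (th l t : R) (A P : 'M[R]_n) (u e : 'cV[R]_n) : R :=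
  excess ((1 + th + l / 2) * t) ((1 + slack th) * dot (A *m e) (A *m e)) +
  2 * excess (l * t / 4) (n%:R^-1 * dot u (P *m e) ^+ 2).

Lemma deviation_ge0 n th l t A P u e : 0 <= @deviation n th l t A P u e.
Proof. by rewrite addr_ge0 ?mulr_ge0 ?excess_ge0. Qed.

(** Homogeneity, p = 2 q - 2 (q - p / 2): extracts the scale rho^(2q) and leaves the dimensionless
    ratio that appears in the remainder. *)
Lemma powR_rescale (rho k x q p : R) : 0 < rho -> 0 < k -> 0 < x ->
  rho `^ p * (k * x) `^ (q - p / 2) =
  k `^ (q - p / 2) * ((rho ^+ 2) `^ q * (x / rho ^+ 2) `^ (q - p / 2)).
Proof.
move=> rho0 k0 x0; have r20 : 0 < rho ^+ 2 by exact: exprn_gt0.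
have r2n : rho ^+ 2 != 0 by rewrite gt_eqF.
have E : (rho ^+ 2) `^ q * (rho ^+ 2)^-1 `^ (q - p / 2) = rho `^ p.
  rewrite -(powR_half_sqr p (ltW rho0)) -(powR_inv1 (ltW r20)) -powRrM -powRD.
    by congr (_ `^ _); lra.
  by apply/implyP => _.
have r2i : 0 <= (rho ^+ 2)^-1 by rewrite invr_ge0 ltW.
by rewrite (powRM _ (ltW k0) (ltW x0)) (powRM _ (ltW x0) r2i) -E; ring.
Qed.

(** Of the level (1 + th + l / 2) t, the part (1 + th) t is consumed by the threshold [c] of the
    norm; the surplus l t / 2 is the level at which the moment q is traded for p / 2. *)
Lemma quadratic_deviation_moment (q p th : R) : 0 < q -> 2 < p -> 2 * q < p ->
  0 < th ->
  exists2 K : R, 0 < K &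
  forall d (T : measurableType d) (Pr : probability T R) (n : nat)
    (eps : 'I_n -> {RV Pr >-> R}) (tau l rho : R) (A : 'M[R]_n),
  let t := \sum_i dot (col i A) (col i A) in
  (0 < n)%N -> standard_noise eps p tau -> 0 < l -> 0 < t ->
  0 < spectral_norm A -> spectral_norm A <= rho ->
  (\int[Pr]_w (excess ((1 + th + l / 2) * t)
     ((1 + slack th) * dot (A *m \col_i eps i w) (A *m \col_i eps i w)) `^ q)%:E
   <= (K * (tau * (rho ^+ 2) `^ q * ((1 + t / spectral_norm A ^+ 2) *
        (l * t / rho ^+ 2) `^ (q - p / 2))))%:E)%E.
Proof.
move=> q0 p2 qp th0; have [s0 s1 s3] := slackP th0.
set s := slack th in s0 s1 s3 *.
have s11 : s <= 1 by lra.
have [C C0 HC] := excess_moment_operator p2 s0 s11.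
pose k := (1 + s) * (1 + s^-1).
have s'0 : 0 < s^-1 by rewrite invr_gt0.
have k0 : 0 < k by rewrite mulr_gt0//; lra.
have qp2 : q <= p / 2 by lra.
exists (k `^ (p / 2) * C * 2^-1 `^ (q - p / 2)).
  by rewrite !mulr_gt0 ?powR_gt0//; lra.
move=> d T Pr n eps tau l rho A t n0 noise l0 t0 r0 rrho.
have tau1 := noise_moment_ge1 n0 p2 noise.
have rho0 : 0 < rho by lra.
pose c := Num.sqrt ((1 + s) * t).
have c2 : c ^+ 2 = (1 + s) * t by rewrite sqr_sqrtr// mulr_ge0// ?ltW//; lra.
have c0 : 0 < c by rewrite sqrtr_gt0 mulr_gt0//; lra.
have r20 : 0 < spectral_norm A ^+ 2 by exact: exprn_gt0.
have Ar v : \sum_i dot (col i A) v ^+ 2 <= spectral_norm A ^+ 2 * dot v v.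
  by rewrite sum_sqr_dot_col dot_trmx_mulmx_le.
have cT : (1 + s) * \sum_i dot (col i A) (col i A) <= c ^+ 2 by rewrite c2.
have := HC _ _ _ _ _ _ A _ _ _ n0 noise c0 r20 Ar cT.
rewrite -/t powR_half_sqr ?(ltW r0)// => HA.
have meps i : measurable_fun setT (eps i) by exact: measurable_funPT.
have mN : measurable_fun setT (fun w => enorm (combine A (eps^~ w))).
  by apply: measurable_enorm => j; exact: measurable_combine.
have mX : measurable_fun setT (fun w => excess c (enorm (combine A (eps^~ w))) `^ p).
  by apply: measurable_fun_powR; exact: measurable_excess.
have lt20 : 0 < l * t / 2 by rewrite divr_gt0// mulr_gt0.
set bq := (l * t / 2) `^ (q - p / 2).
have bq0 : 0 <= bq by exact: powR_ge0.
apply: (@le_trans _ _ (\int[Pr]_w (k `^ (p / 2) * bq *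
    excess c (enorm (combine A (eps^~ w))) `^ p)%:E)%E).
  apply: le_Int.
  - apply: measurable_fun_powR; apply: measurable_excess; apply: measurable_funM => //.
    by apply: measurable_dot => j; exact: measurable_combine.
  - exact: measurable_funM.
  - by move=> w; exact: powR_ge0.
  move=> w; rewrite -/(combine A (eps^~ w)) -sqr_enorm.
  set y := enorm _; have y0 : 0 <= y by exact: enorm_ge0.
  have X0 := excess_ge0 c y.
  have yX : y <= c + excess c y.
    have : y - c <= excess c y by rewrite le_max lexx.
    lra.
  set X := excess c y in X0 yX *.
  have kX : 0 <= k * X ^+ 2 by rewrite mulr_ge0 ?sqr_ge0// ltW.
  have yk : (1 + s) * y ^+ 2 <= (1 + th) * t + k * X ^+ 2.
    (* Expansion of (c + X)^2 with 2 c X <= s c^2 + X^2 / s. *)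
    have y2 : y ^+ 2 <= (1 + s) * c ^+ 2 + (1 + s^-1) * X ^+ 2.
      apply: (@le_trans _ _ ((c + X) ^+ 2)); first by rewrite lerXn2r ?nnegrE//; lra.
      have : 0 <= s^-1 * (s * c - X) ^+ 2 by rewrite mulr_ge0 ?sqr_ge0// ltW.
      have -> : s^-1 * (s * c - X) ^+ 2 = s * c ^+ 2 - 2 * c * X + s^-1 * X ^+ 2.
        by field; rewrite gt_eqF.
      lra.
    have := ler_wpM2l (_ : 0 <= 1 + s) y2; move=> /(_ (ltac:(lra))).
    rewrite c2 /k.
    have : (1 + s) ^+ 3 * t <= (1 + th) * t by rewrite ler_pM2r.
    clear; lra.
  have ee : excess ((1 + th + l / 2) * t) ((1 + s) * y ^+ 2) <=
      excess (l * t / 2) (k * X ^+ 2).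
    rewrite /excess ge_max !le_max lexx orbT andbT; apply/orP; left.
    by move: yk; clear; lra.
  apply: (@le_trans _ _ (excess (l * t / 2) (k * X ^+ 2) `^ q)).
    by rewrite ge0_ler_powR ?nnegrE ?excess_ge0//; lra.
  apply: (le_trans (excess_powR_le lt20 kX q0 qp2)).
  by rewrite (powRM _ (ltW k0) (sqr_ge0 X)) powR_half_sqr// mulrAC.
rewrite IntZ//; [|by rewrite mulr_ge0 ?powR_ge0|by move=> w; exact: powR_ge0].
apply: (@le_trans _ _ ((k `^ (p / 2) * bq)%:E *
   (C * tau * spectral_norm A `^ p * (1 + t / spectral_norm A ^+ 2))%:E)%E).
  by apply: lee_wpmul2l => //; rewrite lee_fin mulr_ge0 ?powR_ge0.
rewrite -EFinM lee_fin.
set tr := 1 + t / _; have tr0 : 0 <= tr.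
  by rewrite /tr addr_ge0//; apply: divr_ge0; exact: ltW.
have lt0 : 0 < l * t by exact: mulr_gt0.
have h2 : (0 : R) < 2^-1 by lra.
have := powR_rescale q p rho0 h2 lt0.
rewrite (mulrC 2^-1) -/bq => E.
have -> : k `^ (p / 2) * C * 2^-1 `^ (q - p / 2) *
  (tau * (rho ^+ 2) `^ q * (tr * (l * t / rho ^+ 2) `^ (q - p / 2))) =
  k `^ (p / 2) * C * tau * tr * (2^-1 `^ (q - p / 2) *
   ((rho ^+ 2) `^ q * (l * t / rho ^+ 2) `^ (q - p / 2))) by ring.
rewrite -E.
have -> : k `^ (p / 2) * bq * (C * tau * spectral_norm A `^ p * tr) =
  k `^ (p / 2) * C * tau * tr * (spectral_norm A `^ p * bq) by ring.
apply: ler_wpM2l.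
  by rewrite !mulr_ge0 ?powR_ge0 ?(ltW C0)//; lra.
rewrite ler_wpM2r// ge0_ler_powR ?nnegrE ?(ltW r0) ?(ltW rho0)//; lra.
Qed.

(** The linear form has coefficient vector P^T u / sqrt n, whose squared norm is at most that of the
    spectral norm of [P]. *)
Lemma linear_deviation_moment (p : R) : 2 < p ->
  exists2 C : R, 0 < C &
  forall d (T : measurableType d) (Pr : probability T R) (n : nat)
    (eps : 'I_n -> {RV Pr >-> R}) (tau : R) (P : 'M[R]_n) (u : 'cV[R]_n),
  (0 < n)%N -> standard_noise eps p tau ->
  0 < spectral_norm P -> dot u u <= n%:R ->
  (\int[Pr]_w ((n%:R^-1 * dot u (P *m \col_i eps i w) ^+ 2) `^ (p / 2))%:E <=
   (C * tau * spectral_norm P `^ p)%:E)%E.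
Proof.
move=> p2; have [C C0 HC] := linear_moment p2; exists C => //.
move=> d T Pr n eps tau P u n0 noise r0 un.
pose v : 'cV[R]_n := Num.sqrt n%:R^-1 *: (P^T *m u).
have n0R : 0 < n%:R :> R by rewrite ltr0n.
have s2 : Num.sqrt (n%:R^-1 : R) ^+ 2 = n%:R^-1 by rewrite sqr_sqrtr ?invr_ge0.
have vr : dot v v <= spectral_norm P ^+ 2.
  rewrite /v dotZl dotZr mulrA -expr2 s2 ler_pdivrMl//.
  apply: (le_trans (dot_trmx_mulmx_le n0 _ _)).
  by rewrite mulrC ler_wpM2r// sqr_ge0.
have := HC _ _ _ _ _ v _ _ n0 noise r0 vr.
under eq_integral do rewrite -powR_half_sqr ?normr_ge0// real_normK ?num_real//.
suff E w : n%:R^-1 * dot u (P *m \col_i eps i w) ^+ 2 = (\sum_i v i 0 * eps i w) ^+ 2.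
  by under [X in _ -> (X <= _)%E]eq_integral do rewrite E.
rewrite -s2 -exprMn -dotZl; congr (_ ^+ 2).
transitivity (dot v (\col_i eps i w)).
  by rewrite /v !dotZl (dotC u) dot_mulmx (dotC (\col_i _)).
by apply: eq_bigr => i _; rewrite [in RHS]/v; congr (_ * _); rewrite mxE.
Qed.

End deviation.

Section deviation_moment.
Context {R : realType}.

(** The two cases are nonzero and null models. A nonzero model has positive levels proportional to l
    t; a null one has level 0 and yields the constant contribution counted by [N0]. *)
Lemma deviation_moment (q p th : R) : 0 < q -> 2 < p -> 2 * q < p -> 0 < th ->
  exists2 K : R, 0 < K &
  forall d (T : measurableType d) (Pr : probability T R) (n : nat)
    (eps : 'I_n -> {RV Pr >-> R}) (tau l : R) (A P : 'M[R]_n) (u : 'cV[R]_n),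
  let t := \sum_i dot (col i A) (col i A) in
  let rho2 := spectral_norm P ^+ 2 in
  (0 < n)%N -> standard_noise eps p tau -> 0 < l ->
  0 < spectral_norm P -> spectral_norm A <= spectral_norm P ->
  dot u u <= n%:R ->
  (0 < t -> 0 < spectral_norm A ->
   (\int[Pr]_w (deviation th l t A P u (\col_i eps i w) `^ q)%:E
    <= (K * (tau * rho2 `^ q * ((1 + t / spectral_norm A ^+ 2) *
        (l * t / rho2) `^ (q - p / 2))))%:E)%E) /\
  (A = 0 ->
   (\int[Pr]_w (deviation th l t A P u (\col_i eps i w) `^ q)%:E
    <= (K * (tau * rho2 `^ q))%:E)%E).
Proof.
move=> q0 p2 qp th0; have [s0 _ _] := slackP th0.
have [K1 K10 H1] := quadratic_deviation_moment q0 p2 qp th0.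
have [C C0 H2] := @linear_deviation_moment R p p2.
have qp2 : q <= p / 2 by lra.
pose k4 := 4^-1 `^ (q - p / 2) : R.
have k40 : 0 < k4 by rewrite powR_gt0//; lra.
have q20 : 0 < 2 `^ q :> R by rewrite powR_gt0.
exists (2 `^ q * (K1 + 2 `^ q * (C * k4)) + 2 `^ q * (2 `^ q * (1 + C))).
  have h1 : 0 < C * k4 by exact: mulr_gt0.
  by rewrite addr_gt0// mulr_gt0// ?addr_gt0// mulr_gt0// addr_gt0.
move=> d T Pr n eps tau l A P u t rho2 n0 noise l0 r0 rA un.
have tau1 := noise_moment_ge1 n0 p2 noise.
have rho20 : 0 < rho2 by exact: exprn_gt0.
have rq0 : 0 <= rho2 `^ q by exact: powR_ge0.
have meps i : measurable_fun setT (eps i) by exact: measurable_funPT.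
pose V w := n%:R^-1 * dot u (P *m \col_i eps i w) ^+ 2.
have V0 w : 0 <= V w by rewrite mulr_ge0 ?sqr_ge0.
have mAe (B : 'M[R]_n) j : measurable_fun setT (fun w => (B *m \col_i eps i w) j 0).
  exact: measurable_combine.
have mV : measurable_fun setT V.
  apply: measurable_funM => //; apply: measurable_funX.
  by apply: measurable_dot.
have mVp : measurable_fun setT (fun w => V w `^ (p / 2)) by exact: measurable_fun_powR.
have IV : (\int[Pr]_w (V w `^ (p / 2))%:E <= (C * tau * spectral_norm P `^ p)%:E)%E.
  exact: H2.
pose Q w := excess ((1 + th + l / 2) * t)
  ((1 + slack th) * dot (A *m \col_i eps i w) (A *m \col_i eps i w)) `^ q.
have mQ : measurable_fun setT Q.
  apply: measurable_fun_powR; apply: measurable_excess; apply: measurable_funM => //.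
  by apply: measurable_dot.
have mdev : measurable_fun setT
    (fun w => deviation th l t A P u (\col_i eps i w) `^ q).
  apply: measurable_fun_powR; apply: measurable_funD.
    by apply: measurable_excess; apply: measurable_funM => //; exact: measurable_dot.
  by apply: measurable_funM => //; exact: measurable_excess.
have Q0 w : 0 <= Q w by exact: powR_ge0.
have Vp0 w : 0 <= V w `^ (p / 2) by exact: powR_ge0.
have K20 : 0 <= 2 `^ q * (2 `^ q * (1 + C)) :> R.
  by do 2 (apply: mulr_ge0; first exact: powR_ge0); rewrite addr_ge0// ltW.
have K30 : 0 <= 2 `^ q * (K1 + 2 `^ q * (C * k4)) :> R.
  apply: mulr_ge0; first exact: powR_ge0.
  apply: addr_ge0; first exact: ltW.
  by apply: mulr_ge0; [exact: powR_ge0|apply: mulr_ge0; exact: ltW].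
split=> [t0 rA0|A0].
- have lt40 : 0 < l * t / 4 by rewrite divr_gt0// mulr_gt0.
  have IQ := H1 _ _ _ _ _ _ _ _ A n0 noise l0 t0 rA0 rA.
  rewrite -/t -/rho2 in IQ.
  set tr := 1 + t / spectral_norm A ^+ 2 in IQ *; have tr1 : 1 <= tr.
    by rewrite lerDl divr_ge0 ?sqr_ge0// (ltW t0).
  set z := (l * t / rho2) `^ (q - p / 2) in IQ *; have z0 : 0 <= z by exact: powR_ge0.
  set b4 := (l * t / 4) `^ (q - p / 2); have b40 : 0 <= b4 by exact: powR_ge0.
  apply: (@le_trans _ _ (\int[Pr]_w (2 `^ q * (Q w + 2 `^ q * b4 * V w `^ (p / 2)))%:E)%E).
    apply: le_Int => //.
    + apply: measurable_funM => //; apply: measurable_funD => //.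
      exact: measurable_funM.
    + by move=> w; exact: powR_ge0.
    move=> w; apply: (le_trans (powRD_le q0 (excess_ge0 _ _) _)).
      by rewrite mulr_ge0 ?excess_ge0.
    rewrite ler_wpM2l ?powR_ge0// lerD2l powRM ?excess_ge0// -[leRHS]mulrA.
    rewrite ler_wpM2l ?powR_ge0//.
    by rewrite [leRHS]mulrC; exact: (excess_powR_le lt40 (V0 w) q0 qp2).
  have c0 : 0 <= 2 `^ q * b4 by rewrite mulr_ge0 ?powR_ge0.
  have mcV : measurable_fun setT (fun w => 2 `^ q * b4 * V w `^ (p / 2)).
    exact: measurable_funM.
  have cV0 w : 0 <= 2 `^ q * b4 * V w `^ (p / 2) by rewrite mulr_ge0.
  rewrite (IntZ Pr (powR_ge0 _ _) (measurable_funD mQ mcV)); last first.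
    by move=> w; rewrite addr_ge0.
  rewrite (IntD Pr mQ mcV)// (IntZ Pr c0 mVp)//.
  apply: (@le_trans _ _ ((2 `^ q)%:E * ((K1 * (tau * rho2 `^ q * (tr * z)))%:E +
    (2 `^ q * b4)%:E * (C * tau * spectral_norm P `^ p)%:E))%E).
    apply: lee_wpmul2l; first by rewrite lee_fin powR_ge0.
    by apply: leeD => //; apply: lee_wpmul2l => //; rewrite lee_fin.
  rewrite -EFinM lee_fin.
  have lt0 : 0 < l * t by exact: mulr_gt0.
  have h4 : (0 : R) < 4^-1 by lra.
  have := powR_rescale q p r0 h4 lt0.
  rewrite (mulrC 4^-1) -/b4 -/rho2 -/k4 -/z => E.
  have -> : 2 `^ q * b4 * (C * tau * spectral_norm P `^ p) =
    2 `^ q * C * tau * (spectral_norm P `^ p * b4) by ring.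
  rewrite E.
  have G0 : 0 <= tau * rho2 `^ q * (tr * z).
    by rewrite !mulr_ge0// ?(le_trans ler01 tau1) ?(le_trans ler01 tr1).
  have := mulr_ge0 K20 G0.
  have : 0 <= 2 `^ q * (2 `^ q * (C * k4)) * (tau * rho2 `^ q * z) * (tr - 1).
    apply: mulr_ge0; last by rewrite subr_ge0.
    by rewrite !mulr_ge0 ?powR_ge0 ?(ltW C0) ?(le_trans ler01 tau1).
  clear; lra.
- have dA (e : 'cV[R]_n) : deviation th l t A P u e = 2 * (n%:R^-1 * dot u (P *m e) ^+ 2).
    have t00 : t = 0.
      by rewrite /t A0 big1// => i _; rewrite /dot big1// => j _; rewrite !mxE mul0r.
    rewrite /deviation t00 A0 mul0mx dot0 !mulr0 mul0r excess_eq0// add0r.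
    by rewrite excessE ?subr0// mulr_ge0 ?sqr_ge0.
  under eq_integral do rewrite dA.
  (* Since the level is 0 here, [rho2] is introduced as an artificial level: V is at most rho2 plus
     its excess over rho2. *)
  pose bq := rho2 `^ (q - p / 2); have bq0 : 0 <= bq by exact: powR_ge0.
  apply: (@le_trans _ _ (\int[Pr]_w (2 `^ q * (2 `^ q * (rho2 `^ q + bq * V w `^ (p / 2))))%:E)%E).
    apply: le_Int.
    + by apply: measurable_fun_powR; exact: measurable_funM.
    + do 2 (apply: measurable_funM => //); apply: measurable_funD => //.
      exact: measurable_funM.
    + by move=> w; exact: powR_ge0.
    move=> w; rewrite powRM ?V0// ler_wpM2l ?powR_ge0// -/(V w).
    have Vx : V w <= rho2 + excess rho2 (V w).
      have : V w - rho2 <= excess rho2 (V w) by rewrite le_max lexx.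
      lra.
    apply: (@le_trans _ _ ((rho2 + excess rho2 (V w)) `^ q)).
      by rewrite ge0_ler_powR ?nnegrE ?addr_ge0 ?excess_ge0 ?V0 ?(ltW rho20) ?(ltW q0).
    apply: (le_trans (powRD_le q0 (ltW rho20) (excess_ge0 _ _))).
    rewrite ler_wpM2l ?powR_ge0// lerD2l mulrC.
    by have := excess_powR_le rho20 (V0 w) q0 qp2; rewrite mulrC.
  have mcV : measurable_fun setT (fun w => bq * V w `^ (p / 2)).
    exact: measurable_funM.
  have cV0 w : 0 <= bq * V w `^ (p / 2) by rewrite mulr_ge0.
  have mcV' : measurable_fun setT (fun w => rho2 `^ q + bq * V w `^ (p / 2)).
    exact: measurable_funD.
  have cV0' w : 0 <= rho2 `^ q + bq * V w `^ (p / 2) by rewrite addr_ge0.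
  rewrite (IntZ Pr (powR_ge0 _ _) (measurable_funM (measurable_cst _) mcV')); last first.
    by move=> w; rewrite mulr_ge0 ?powR_ge0.
  rewrite (IntZ Pr (powR_ge0 _ _) mcV')// (IntD Pr (measurable_cst _) mcV)//; last first.
  rewrite Int_cst (IntZ Pr bq0 mVp)//.
  apply: (@le_trans _ _ ((2 `^ q)%:E * ((2 `^ q)%:E * ((rho2 `^ q)%:E +
    bq%:E * (C * tau * spectral_norm P `^ p)%:E)))%E).
    apply: lee_wpmul2l; first by rewrite lee_fin powR_ge0.
    apply: lee_wpmul2l; first by rewrite lee_fin powR_ge0.
    by apply: leeD => //; apply: lee_wpmul2l => //; rewrite lee_fin.
  rewrite -EFinM lee_fin.
  have := powR_rescale q p r0 (ltr01 : 0 < 1) rho20.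
  rewrite mul1r -/rho2 divff ?gt_eqF// !powR1 mul1r mulr1 -/bq => E.
  have -> : bq * (C * tau * spectral_norm P `^ p) =
    C * tau * (spectral_norm P `^ p * bq) by ring.
  rewrite E.
  have G0 : 0 <= tau * rho2 `^ q by rewrite mulr_ge0//; lra.
  have := mulr_ge0 K30 G0.
  have : 0 <= 2 `^ q * 2 `^ q * rho2 `^ q * (tau - 1).
    by apply: mulr_ge0; [rewrite !mulr_ge0 ?powR_ge0|lra].
  clear; lra.
Qed.

End deviation_moment.

Section oracle.
Context {R : realType} {n : nat}.
Implicit Types (s e x : 'cV[R]_n) (P : 'M[R]_n) (U : {vspace 'cV[R]_n}).
Hypothesis n0 : (0 < n)%N.

Lemma model_traceE (M : countType) P (S : M -> {vspace 'cV[R]_n}) m :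
  let A := orthoproj (S m) *m P in
  model_trace P S m = \sum_i dot (col i A) (col i A).
Proof. by rewrite /model_trace tr_orthoproj// sum_dot_col. Qed.

(* Zero when [s] lies in [U], since 0^-1 = 0. *)
Definition bias_direction U s : 'cV[R]_n :=
  let g := s - orthoproj U *m s in (norm_n g)^-1 *: g.

Lemma norm_n_eq0 x : (norm_n x == 0) = (x == 0).
Proof.
rewrite norm_nE mulf_eq0 enorm_eq0 sqrtr_eq0 leNgt invr_gt0 ltr0n n0.
by [].
Qed.

Lemma dot_bias_direction U s :
  dot (bias_direction U s) (bias_direction U s) <= n%:R.
Proof.
rewrite /bias_direction; set g := s - _; rewrite dotZl dotZr mulrA -expr2.
have n0R : 0 < n%:R :> R by rewrite ltr0n.
have -> : dot g g = n%:R * norm_n g ^+ 2.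
  by rewrite sqr_norm_n mulrA mulfV ?mul1r// gt_eqF.
have [->|g0] := eqVneq (norm_n g) 0; first by rewrite invr0 expr0n mul0r ler0n.
by rewrite exprVn mulrCA mulVf ?mulr1// sqrf_eq0.
Qed.

Lemma dot_bias U s x : let g := s - orthoproj U *m s in
  dot g x = norm_n g * dot (bias_direction U s) x.
Proof.
move=> g; rewrite /bias_direction -/g dotZl mulrA.
have [/eqP|g0] := eqVneq (norm_n g) 0; last by rewrite mulfV// mul1r.
by rewrite norm_n_eq0 => /eqP ->; rewrite dotC dot0 mulr0.
Qed.

Lemma orthoproj_residual U s x : dot (s - orthoproj U *m s) (orthoproj U *m x) = 0.
Proof.
by rewrite orthoproj_dotr// mulmxBr (orthoproj_id n0 (orthoproj_mem _ _)) subrr dotC dot0.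
Qed.

Lemma residual_noise U s x (A := norm_n (s - orthoproj U *m s)) :
  norm_n (s + x - orthoproj U *m (s + x)) ^+ 2 =
    A ^+ 2 + n%:R^-1 * (2 * (A * dot (bias_direction U s) x) + dot x x
                        - dot (orthoproj U *m x) (orthoproj U *m x)) /\
  norm_n (s - orthoproj U *m (s + x)) ^+ 2 =
    A ^+ 2 + n%:R^-1 * dot (orthoproj U *m x) (orthoproj U *m x).
Proof.
rewrite /A !sqr_norm_n -dot_bias mulmxDr.
have r0 := orthoproj_residual U s x.
set g := s - orthoproj U *m s in r0 *; set y := orthoproj U *m x in r0 *.
have -> : s + x - (orthoproj U *m s + y) = g + (x - y).
  by rewrite opprD addrACA.
have -> : s - (orthoproj U *m s + y) = g - y by rewrite opprD addrA.
have yx := orthoproj_pythagoras n0 U x; rewrite -/y in yx.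
clearbody g y.
split; last first.
  by rewrite dotBl !dotBr (dotC y g) r0; ring.
have gz : dot g (x - y) = dot g x by rewrite dotBr r0 subr0.
move: (x - y) gz yx => z gz ->.
by rewrite dotDl !dotDr (dotC z g) gz; ring.
Qed.

(** The penalty at m' dominates the centring of both deviations: its L t is shared as L / 2 for the
    quadratic form and twice L / 4 for the linear one. The linear form at m' is paid by half of the
    squared bias there; the other half, with the extra [slack] on the quadratic form, leaves slack
    times the loss. At m the bias and the penalty are at most doubled. *)
Lemma oracle_inequality (M : countType) P (S : M -> {vspace 'cV[R]_n})
    (L pen : M -> R) s e sigma th m m' :
  let dev k := deviation th (L k) (model_trace P S k) (orthoproj (S k) *m P) P
    (bias_direction (S k) s) e in
  let Y := s + sigma *: (P *m e) in
  0 < th -> (forall k, 0 < L k) ->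
  (forall k, (1 + th + L k) * (model_trace P S k / n%:R) * sigma ^+ 2 <= pen k) ->
  penalized_criterion S pen Y m' <= penalized_criterion S pen Y m ->
  slack th * norm_n (s - least_squares S Y m') ^+ 2 <=
  2 * (norm_n (s - orthoproj (S m) *m s) ^+ 2 + pen m) +
  sigma ^+ 2 / n%:R * (dev m' + dev m).
Proof.
move=> dev Y th0 L0 hpen; rewrite /penalized_criterion /least_squares /Y.
set x := sigma *: _.
have [-> _] := residual_noise (S m) s x.
have [-> ->] := residual_noise (S m') s x.
have [s0 s1 _] := slackP th0.
set N : R := n%:R^-1; have N0 : 0 <= N by rewrite invr_ge0.
have c0 : 0 <= sigma ^+ 2 * N by rewrite mulr_ge0 ?sqr_ge0.
have dE U : dot (orthoproj U *m x) (orthoproj U *m x) =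
    sigma ^+ 2 * dot (orthoproj U *m P *m e) (orthoproj U *m P *m e).
  by rewrite /x -scalemxAr dotZl dotZr mulrA -expr2 mulmxA.
rewrite !dE /x !dotZr.
have t0 k : 0 <= model_trace P S k.
  by rewrite model_traceE sumr_ge0// => i _; exact: dot_ge0.
have dev1 k : (1 + slack th) *
    dot (orthoproj (S k) *m P *m e) (orthoproj (S k) *m P *m e)
    - (1 + th + L k / 2) * model_trace P S k
    + 2 * (N * dot (bias_direction (S k) s) (P *m e) ^+ 2
           - L k * model_trace P S k / 4) <= dev k.
  rewrite /dev /deviation -/N; apply: lerD; first by rewrite le_max lexx.
  by rewrite ler_pM2l// le_max lexx.
have dev2 k : 2 * (N * dot (bias_direction (S k) s) (P *m e) ^+ 2
    - L k * model_trace P S k / 4) <= dev k.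
  rewrite /dev /deviation -/N ler_wpDl ?excess_ge0// ler_pM2l//.
  by rewrite le_max lexx.
have dev0 k : 0 <= dev k by exact: deviation_ge0.
have := ler_wpM2l c0 (dev1 m'); have := ler_wpM2l c0 (dev2 m).
have := mulr_ge0 c0 (dev0 m).
have := hpen m; have := hpen m'; rewrite -/N.
have : 0 <= (1 + th + 3 / 4 * L m) * model_trace P S m * (sigma ^+ 2 * N).
  by apply: mulr_ge0 => //; apply: mulr_ge0 => //; have := L0 m; lra.
have : 0 <= sigma ^+ 2 * N *
    dot (orthoproj (S m) *m P *m e) (orthoproj (S m) *m P *m e).
  by rewrite mulr_ge0 ?dot_ge0.
set A := norm_n (s - orthoproj (S m) *m s).
set A' := norm_n (s - orthoproj (S m') *m s).
set B := dot (bias_direction (S m) s) (P *m e).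
set B' := dot (bias_direction (S m') s) (P *m e).
set T := model_trace P S m; set T' := model_trace P S m'.
set D := dev m; set D' := dev m'.
(* These squares split the two bias-noise products: at m against A^2, at m' (after halving) against
   A'^2 / 2. *)
have : 0 <= (A - N * (sigma * B)) ^+ 2 by exact: sqr_ge0.
have : 0 <= (A' + 2 * (N * (sigma * B'))) ^+ 2 by exact: sqr_ge0.
have : 0 <= (2^-1 - slack th) * A' ^+ 2 by rewrite mulr_ge0 ?sqr_ge0//; lra.
clear; lra.
Qed.

End oracle.

(** * From the oracle inequality to the expected risk *)

Section risk_bound.
Context {R : realType}.

Lemma orthoproj_zero n U k (P : 'M[R]_(n, k)) : U = 0%VS -> orthoproj U *m P = 0.
Proof.
move=> U0; suff -> : orthoproj U = 0 by rewrite mul0mx.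
apply/matrixP => i j; have := orthoproj_mem U (delta_mx j 0 : 'cV_n).
by rewrite U0 memv0 -colE => /eqP/colP/(_ i); rewrite !mxE.
Qed.

(** A nonzero vector of [U] has the form P z and is fixed by the projection. Hence a nonzero model
    has positive trace and positive spectral norm, as required for trading moments. *)
Lemma orthoproj_image_neq0 n (U : {vspace 'cV[R]_n}) (P : 'M[R]_n) :
  (0 < n)%N -> (U <= image_mx P)%VS -> U != 0%VS ->
  exists z : 'cV[R]_n, orthoproj U *m P *m z != 0.
Proof.
move=> n0 UP U0; have [z zE] := (mem_image_mxP P (vpick U)).1 (subvP UP _ (memv_pick U)).
by exists z; rewrite -mulmxA -zE orthoproj_id ?memv_pick// vpick0.
Qed.

Lemma spectral_norm_orthoproj_le n (U : {vspace 'cV[R]_n}) (P : 'M[R]_n) :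
  (0 < n)%N -> spectral_norm (orthoproj U *m P) <= spectral_norm P.
Proof.
move=> n0; apply: spectral_norm_le => // x; rewrite -mulmxA.
by rewrite (le_trans (enorm_orthoproj_le n0 _ _))// enorm_mulmx_le.
Qed.

Lemma measurable_norm_n d (T : measurableType d) n (u : T -> 'cV[R]_n) :
  (forall j, measurable_fun setT (fun w => u w j 0)) ->
  measurable_fun setT (fun w => norm_n (u w)).
Proof.
move=> mu; under eq_fun do rewrite norm_nE.
by apply: measurable_funM => //; exact: measurable_enorm.
Qed.

Lemma powR_split_le (q de a c x y X : R) : 0 < q -> 0 < de -> 0 <= a -> 0 <= c ->
  0 <= x -> 0 <= y -> 0 <= X -> de * X <= 2 * a + c * (x + y) ->
  X `^ q <= (4 / de) `^ q * a `^ q + (4 / de) `^ q * c `^ q * (x `^ q + y `^ q).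
Proof.
move=> q0 de0 a0 c0 x0 y0 X0 h.
have d'0 : 0 < de^-1 by rewrite invr_gt0.
have d'0' := ltW d'0.
have X1 : X <= de^-1 * (2 * a + c * (x + y)).
  by rewrite mulrC ler_pdivlMr// mulrC.
have xy0 : 0 <= c * (x + y) by rewrite mulr_ge0// addr_ge0.
have a20 : 0 <= 2 * a by rewrite mulr_ge0.
apply: (@le_trans _ _ ((de^-1 * (2 * a + c * (x + y))) `^ q)).
  by rewrite ge0_ler_powR ?nnegrE ?(ltW q0)// mulr_ge0// addr_ge0.
rewrite powRM ?addr_ge0//.
apply: (@le_trans _ _ (de^-1 `^ q * (2 `^ q * ((2 * a) `^ q + (c * (x + y)) `^ q)))).
  by rewrite ler_wpM2l ?powR_ge0// powRD_le.
(* One 2 comes from separating the two summands; the other is the coefficient of [a] in one of them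
   and the separation of x + y in the other. *)
have E4 : (4 / de) `^ q = de^-1 `^ q * (2 `^ q * 2 `^ q).
  by rewrite powRM// mulrC -powRM//; congr (_ * _ `^ _); ring.
rewrite E4 (powRM _ _ a0)// (powRM _ c0) ?addr_ge0//.
have := powRD_le q0 x0 y0 => /(ler_wpM2l (_ : 0 <= de^-1 `^ q * 2 `^ q * c `^ q)).
rewrite !mulr_ge0 ?powR_ge0// => /(_ isT); clear; lra.
Qed.

(** The factor of the oracle term depends on [q] and [th] only; [p] affects [K] alone, which lets
    the leading constant be fixed before [p]. *)
Lemma expected_risk_le (q th p : R) : 0 < q -> 0 < th -> 2 < p -> 2 * q < p ->
  exists2 K : R, 0 < K &
  forall (d : measure_display) (T : measurableType d) (Pr : probability T R)
    (n : nat) (P : 'M[R]_n) (s : 'cV[R]_n) (sigma : R)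
    (eps : 'I_n -> {RV Pr >-> R}) (tau : R)
    (M : countType) (S : M -> {vspace 'cV[R]_n})
    (L pen : M -> R) (mhat : T -> M),
  let Y w : 'cV[R]_n := s + sigma *: (P *m \col_i eps i w) in
  let stilde w : 'cV[R]_n := least_squares S (Y w) (mhat w) in
  (0 < n)%N -> standard_noise eps p tau -> 0 < spectral_norm P ->
  (forall m, (S m <= image_mx P)%VS) ->
  (forall m, 0 < L m) -> (forall m, 0 <= pen m) ->
  (forall m, (1 + th + L m) * (model_trace P S m / n%:R) * sigma ^+ 2 <= pen m) ->
  (forall w m, penalized_criterion S pen (Y w) (mhat w)
               <= penalized_criterion S pen (Y w) m) ->
  (forall i, measurable_fun setT (fun w => stilde w i 0)) ->
  forall m,
  (\int[Pr]_w (norm_n (s - stilde w) `^ (2 * q))%:E <=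
   ((4 / slack th) `^ q *
      (norm_n (s - orthoproj (S m) *m s) ^+ 2 + pen m) `^ q)%:E +
   (K * tau * (spectral_norm P ^+ 2 * sigma ^+ 2 / n%:R) `^ q)%:E *
   (@N0 R n M S + \esum_(m in [set m | S m != 0%VS])
     ((1 + model_trace P S m / spectral_norm (orthoproj (S m) *m P) ^+ 2) *
      (L m * model_trace P S m / spectral_norm P ^+ 2) `^ (q - p / 2))%:E))%E.
Proof.
move=> q0 th0 p2 qp; have [K K0 HK] := deviation_moment q0 p2 qp th0.
have [de0 _ _] := slackP th0.
set al := (4 / slack th) `^ q; have al0 : 0 < al by rewrite powR_gt0// divr_gt0.
exists (2 * (K * al)); first by rewrite !mulr_gt0.
move=> d T Pr n P s sigma eps tau M S L pen mhat Y stilde n0 noise r0 SP L0 pen0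
  hpen crit mst m.
have tau1 := noise_moment_ge1 n0 p2 noise.
set a := _ + pen m; have a0 : 0 <= a by rewrite addr_ge0 ?sqr_ge0.
pose c := sigma ^+ 2 / n%:R; have c0 : 0 <= c by rewrite mulr_ge0 ?sqr_ge0 ?invr_ge0.
pose dev k w := deviation th (L k) (model_trace P S k) (orthoproj (S k) *m P) P
  (bias_direction (S k) s) (\col_i eps i w).
(* Giving null models the weight 1 merges [N0] and the series into a single sum over all models. *)
pose t k : R := if S k == 0%VS then 1 else
  (1 + model_trace P S k / spectral_norm (orthoproj (S k) *m P) ^+ 2) *
      (L k * model_trace P S k / spectral_norm P ^+ 2) `^ (q - p / 2).
have mt0 k : 0 <= model_trace P S k.
  by rewrite model_traceE// sumr_ge0// => i _; exact: dot_ge0.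
have t0 k : 0 <= t k.
  rewrite /t; case: ifP => // _; apply: mulr_ge0; last exact: powR_ge0.
  by rewrite addr_ge0// divr_ge0 ?sqr_ge0.
have dev0 k w : 0 <= dev k w by exact: deviation_ge0.
have meps i : measurable_fun setT (eps i) by exact: measurable_funPT.
have mAe (B : 'M[R]_n) j : measurable_fun setT (fun w => (B *m \col_i eps i w) j 0).
  exact: measurable_combine.
have mdev k : measurable_fun setT (fun w => dev k w `^ q).
  apply: measurable_fun_powR; apply: measurable_funD.
    by apply: measurable_excess; apply: measurable_funM => //; exact: measurable_dot.
  apply: measurable_funM => //; apply: measurable_excess.
  apply: measurable_funM => //; apply: measurable_funX.
  by apply: measurable_dot.
pose f k w := al * c `^ q * dev k w `^ q.
have alc0 : 0 <= al * c `^ q by rewrite mulr_ge0 ?powR_ge0.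
have f0 k w : 0 <= f k w by rewrite mulr_ge0 ?powR_ge0.
have mf k : measurable_fun setT (f k) by exact: measurable_funM.
pose K' := K * al * tau * (spectral_norm P ^+ 2 * sigma ^+ 2 / n%:R) `^ q.
have K'0 : 0 <= K' by rewrite !mulr_ge0 ?powR_ge0 ?(ltW K0) ?(ltW al0)//; lra.
have ft k : (\int[Pr]_w (f k w)%:E <= (K' * t k)%:E)%E.
  rewrite IntZ//; last by move=> w; exact: powR_ge0.
  have tE : (\int[Pr]_w (dev k w `^ q)%:E <=
      (K * (tau * (spectral_norm P ^+ 2) `^ q * t k))%:E)%E.
    have := HK _ _ _ _ _ _ (L k) (orthoproj (S k) *m P) _ _ n0 noise (L0 k) r0
      (spectral_norm_orthoproj_le _ _ n0) (dot_bias_direction n0 (S k) s).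
    rewrite -model_traceE// => -[H1 H2].
    rewrite /t; have [Sk|Sk] := eqVneq (S k) 0%VS.
      by rewrite mulr1; apply: H2; exact: orthoproj_zero.
    have [z zn] := orthoproj_image_neq0 n0 (SP k) Sk.
    apply: H1; last exact: spectral_norm_gt0 zn.
    by rewrite model_traceE//; exact: sum_dot_col_gt0 zn.
  apply: (@le_trans _ _ ((al * c `^ q)%:E *
    (K * (tau * (spectral_norm P ^+ 2) `^ q * t k))%:E)%E).
    by apply: lee_wpmul2l.
  rewrite -EFinM lee_fin /K' -[spectral_norm P ^+ 2 * _ / _]mulrA -/c.
  by rewrite powRM ?sqr_ge0// le_eqVlt; apply/orP; left; apply/eqP; ring.
pose X w := norm_n (s - stilde w) `^ (2 * q).
have XE w : X w = (norm_n (s - stilde w) ^+ 2) `^ q.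
  by rewrite /X powRrM powR_mulrn// norm_n_ge0.
have Xle w : X w <= al * a `^ q + f m w + f (mhat w) w.
  have := oracle_inequality n0 (m := m) (m' := mhat w) th0 L0 hpen (crit w m).
  move=> /(powR_split_le q0 de0 a0 c0 (dev0 _ _) (dev0 _ _) (sqr_ge0 _)).
  move=> H; rewrite XE -addrA [f m w + _]addrC /f -mulrDr; exact: H.
have mX : measurable_fun setT X.
  apply: measurable_fun_powR; apply: measurable_norm_n => j.
  under eq_fun do rewrite mxE [X in _ + X]mxE.
  by apply: measurable_funD => //; apply: measurable_funN; exact: mst.
have X0 w : 0 <= X w by exact: powR_ge0.
have ala0 : 0 <= al * a `^ q by rewrite mulr_ge0 ?powR_ge0.
(* What the deviation at mhat must cover. It is measurable because the estimator is, whatever [mhat]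
   may be. *)
pose g w := Num.max (X w - (al * a `^ q + f m w)) 0.
have mg : measurable_fun setT g.
  apply: measurable_maxr => //; apply: measurable_funB => //.
  exact: measurable_funD.
have g0 w : 0 <= g w by rewrite le_max lexx orbT.
have gf w : g w <= f (mhat w) w.
  by rewrite ge_max f0 andbT lerBlDl; exact: Xle.
have Ig := integral_random_index_le mf f0 mg g0 gf K'0 t0 ft.
have fm0 w : 0 <= f m w by exact: f0.
have afm0 w : 0 <= al * a `^ q + f m w by rewrite addr_ge0.
have mafm : measurable_fun setT (fun w => al * a `^ q + f m w) by exact: measurable_funD.
apply: (@le_trans _ _ (\int[Pr]_w (al * a `^ q + f m w + g w)%:E)%E).
  apply: le_Int => //; first exact: measurable_funD.
  by move=> w; rewrite -lerBlDl le_max lexx.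
rewrite (IntD Pr mafm mg)// (IntD Pr (measurable_cst _) (mf m))// Int_cst -addeA.
apply: leeD => //.
set Et := (\esum_(m in [set: M]) (t m)%:E)%E in Ig.
(* The deviation at the fixed m is one term of the sum, so it is charged to the whole sum a second
   time: hence the 2 in the constant. *)
have tEt : ((t m)%:E <= Et)%E.
  apply: esum_ge; exists [set m]; first by split.
  by rewrite fsbig_set1.
have Et0 : (0 <= Et)%E by apply: esum_ge0 => k _; rewrite lee_fin.
apply: (@le_trans _ _ ((2 * K')%:E * Et)%E).
  apply: (@le_trans _ _ (K'%:E * Et + K'%:E * Et)%E).
    apply: leeD => //; apply: (le_trans (ft m)); rewrite EFinM.
    exact: lee_wpmul2l.
  by rewrite mulr_natl mulr2n EFinD ge0_muleDl.
have -> : 2 * (K * al) * tau * (spectral_norm P ^+ 2 * sigma ^+ 2 / n%:R) `^ q = 2 * K'.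
  by rewrite /K'; ring.
apply: lee_wpmul2l; first by rewrite lee_fin mulr_ge0.
rewrite /Et (esumID [set k | S k == 0%VS]); last by move=> k _; rewrite lee_fin.
rewrite !setTI; apply: leeD.
  rewrite /N0 (_ : [set k | _ = 0%N] = [set k | S k == 0%VS]); last first.
    by apply/seteqP; split=> k /=; rewrite -dimv_eq0 => /eqP.
  apply: (@le_trans _ _ (\esum_(k in [set k | S k == 0%VS]) (1 : \bar R))%E).
    by apply: le_esum => k /= Sk; rewrite /t Sk.
  exact: esum_one_le_counting.
rewrite (_ : ~` _ = [set k | S k != 0%VS]); last first.
  by apply/seteqP; split=> k /= /negP.
by apply: le_esum => k /= /negbTE Sk; rewrite /t Sk.
Qed.

End risk_bound.

Theorem theorem2p2 (R : realType) (q theta : R) (q_gt0 : 0 < q)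
    (theta_gt0 : 0 < theta) :
  exists2 C : R, 0 < C &
  forall p : R, 2 < p -> 2 * (q + 1) < p ->
  exists2 C' : R, 0 < C' &
  forall (d : measure_display) (T : measurableType d) (Pr : probability T R)
    (n : nat) (P : 'M[R]_n) (s : 'cV[R]_n) (sigma : R)
    (eps : 'I_n -> {RV Pr >-> R}) (tau : R)
    (M : countType) (S : M -> {vspace 'cV[R]_n})
    (L pen : M -> R) (mhat : T -> M),
  let Y w : 'cV[R]_n := s + sigma *: (P *m \col_i eps i w) in
  let stilde w : 'cV[R]_n := least_squares S (Y w) (mhat w) in
  (0 < n)%N ->
  s \in image_mx P ->
  0 < sigma ->
  iid eps ->
  (forall i, 'E_Pr[eps i] = 0)%E ->
  (forall i, 'V_Pr[eps i] = 1)%E ->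
  (forall i, 'E_Pr[fun w => (`|eps i w| `^ p)%R] = tau%:E)%E ->
  (forall m, (S m <= image_mx P)%VS) ->
  (forall m, 0 < L m) ->
  (forall m, 0 <= pen m) ->
  (forall m, (1 + theta + L m) * (model_trace P S m / n%:R) * sigma ^+ 2
             <= pen m) ->
  (forall w m, penalized_criterion S pen (Y w) (mhat w)
               <= penalized_criterion S pen (Y w) m) ->
  (forall i, measurable_fun setT (fun w => stilde w i 0)) ->
  ('E_Pr[fun w => (norm_n (s - stilde w) `^ (2 * q))%R] `^ q^-1
   <= C%:E * ereal_inf [set (norm_n (s - orthoproj (S m) *m s) ^+ 2
                             + pen m)%R%:E | m in [set: M]]
      + (spectral_norm P ^+ 2 * sigma ^+ 2 / n%:R)%R%:E
        * remainder P S C' tau p q L `^ q^-1)%E.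
Proof.
have [de0 _ _] := slackP theta_gt0.
have qi0 : 0 < q^-1 by rewrite invr_gt0.
have d40 : 0 < 4 / slack theta by exact: divr_gt0.
(* The first factor comes from the power 1/q of a sum of two terms, the second is the 4 / slack of
   the risk bound. *)
exists (2 `^ q^-1 * (4 / slack theta)); first by rewrite mulr_gt0 ?powR_gt0.
move=> p p2 qp; have qp' : 2 * q < p by lra.
have [K K0 HK] := expected_risk_le q_gt0 theta_gt0 p2 qp'.
(* The factor 2 to the power 1/q in front of the remainder goes inside its power 1/q as a plain
   2. *)
exists (2 * K); first exact: mulr_gt0.
move=> d T Pr n P s sigma eps tau M S L pen mhat Y stilde n0 sP sigma0 [indep _]
  E1 V1 Ep SP L0 pen0 hpen crit mst.
have noise : standard_noise eps p tau.
  split=> //.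
  - by move=> i; have := E1 i; rewrite unlock.
  - move=> i; have := V1 i; rewrite /variance unlock E1 unlock => <-.
    apply: eq_integral => w _; congr EFin.
    by rewrite -[RHS]/((eps i w - 0) * (eps i w - 0)) subr0.
  - by move=> i; have := Ep i; rewrite unlock.
rewrite unlock.
pose J : set (\bar R) := [set (norm_n (s - orthoproj (S m) *m s) ^+ 2
                             + pen m)%R%:E | m in [set: M]].
have J0 : (0 <= ereal_inf J)%E.
  apply: le_ereal_inf_tmp => _ [m _ <-].
  by rewrite lee_fin addr_ge0 ?sqr_ge0.
rewrite -/J; set C := 2 `^ q^-1 * _.
have C0 : 0 < C by rewrite mulr_gt0 ?powR_gt0.
have CJ0 : (0 <= C%:E * ereal_inf J)%E by rewrite mule_ge0 ?lee_fin ?(ltW C0).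
(* Degenerate case, where the remainder divides by zero: then P = 0, so s = 0 and the loss vanishes
   identically. *)
have [P0|Pn] := eqVneq (spectral_norm P) 0.
  have Pz (z : 'cV[R]_n) : P *m z = 0.
    apply/eqP; rewrite -enorm_eq0 eq_le enorm_ge0 andbT.
    by rewrite (le_trans (enorm_mulmx_le n0 _ _))// P0 mul0r.
  have s0 : s = 0 by have [z ->] := (mem_image_mxP P s).1 sP; rewrite Pz.
  have st0 w : norm_n (s - stilde w) `^ (2 * q) = 0.
    rewrite /stilde /least_squares /Y s0 Pz scaler0 addr0 mulmx0 subr0.
    have /eqP -> : norm_n (0 : 'cV[R]_n) == 0 by rewrite norm_n_eq0.
    by rewrite powR0// gt_eqF// mulr_gt0.
  under eq_integral do rewrite st0.
  rewrite Int_cst poweR0r ?gt_eqF// adde_ge0// mule_ge0 ?poweR_ge0// lee_fin.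
  by rewrite P0 expr0n !mul0r.
have r0 : 0 < spectral_norm P by rewrite lt_def Pn spectral_norm_ge0.
have tau1 := noise_moment_ge1 n0 p2 noise.
pose rho := spectral_norm P ^+ 2 * sigma ^+ 2 / n%:R.
have rho0 : 0 < rho by rewrite divr_gt0 ?ltr0n// mulr_gt0 ?exprn_gt0.
have := HK _ _ _ _ _ _ _ _ _ _ _ _ _ _ n0 noise r0 SP L0 pen0 hpen crit mst.
rewrite /remainder -/rho.
set B := (N0 S + _)%E; set I := (\int[Pr]_w _)%E => HI.
have B0 : (0 <= B)%E.
  apply: adde_ge0.
    by rewrite /N0 /counting; case: asboolP => _; rewrite ?leey// lee_fin.
  apply: esum_ge0 => m _; rewrite lee_fin mulr_ge0 ?powR_ge0// addr_ge0//.
  by rewrite divr_ge0 ?sqr_ge0// model_traceE// sumr_ge0// => i _; exact: dot_ge0.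
have I0 : (0 <= I)%E by apply: integral_ge0 => w _; rewrite lee_fin powR_ge0.
have Ct0 : 0 < 2 * K * tau by rewrite !mulr_gt0// (lt_le_trans ltr01).
(* An infinite remainder makes the right side infinite, since its factors are positive (tau >=
   1). *)
have [Boo|Bfin] := eqVneq B +oo%E.
  rewrite Boo -EFinM gt0_muley ?lte_fin// poweRyr ?gt_eqF//.
  by rewrite gt0_muley ?lte_fin// addey ?leey// gt_eqF// (lt_le_trans _ CJ0).
have Bf : B \is a fin_num by rewrite ge0_fin_numE// lt_neqAle Bfin leey.
move: HI; rewrite -(fineK Bf); set b := fine B => HI.
have b0 : 0 <= b by rewrite fine_ge0.
(* [mhat] itself provides a model, whose bound shows that the risk is finite. *)
pose m0 : M := mhat point.
have Ifin : I \is a fin_num.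
  by rewrite ge0_fin_numE// (le_lt_trans (HI m0))// -EFinM -EFinD ltry.
move: HI; rewrite -(fineK Ifin); set x := fine I => HI.
have x0 : 0 <= x by rewrite fine_ge0.
rewrite -!EFinM !poweR_EFin.
set B' := rho * _.
have key m : x `^ q^-1 <= C * (norm_n (s - orthoproj (S m) *m s) ^+ 2 + pen m) + B'.
  have := HI m; set a := _ + pen m.
  have a0 : 0 <= a by rewrite addr_ge0 ?sqr_ge0.
  rewrite -EFinM -EFinD lee_fin => xle.
  set u := _ * a `^ q in xle; set v := _ * b in xle.
  have u0 : 0 <= u by rewrite mulr_ge0 ?powR_ge0.
  have v0 : 0 <= v.
    by rewrite !mulr_ge0 ?powR_ge0 ?(ltW K0) ?(le_trans ler01 tau1).
  apply: (@le_trans _ _ ((u + v) `^ q^-1)).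
    by rewrite ge0_ler_powR ?nnegrE ?addr_ge0// ltW.
  apply: (le_trans (powRD_le qi0 u0 v0)).
  have powK y : 0 <= y -> (y `^ q) `^ q^-1 = y.
    by move=> y0; rewrite -powRrM mulfV ?powRr1// gt_eqF.
  have -> : u `^ q^-1 = 4 / slack theta * a.
    by rewrite /u -powRM ?(ltW d40)// powK// mulr_ge0// ltW.
  rewrite mulrDr mulrA -/C lerD2l -powRM//.
  have -> : 2 * v = rho `^ q * (2 * K * tau * b) by rewrite /v; ring.
  have z0 : 0 <= 2 * K * tau * b by rewrite mulr_ge0// ltW.
  by rewrite (powRM _ (powR_ge0 _ _) z0) powK// ltW.
(* The infimum need not be attained: the bound for each m is solved for its oracle term, which
   exhibits a lower bound of the whole set. *)
have lb : (((x `^ q^-1 - B') / C)%:E <= ereal_inf J)%E.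
  apply: le_ereal_inf_tmp => _ [m _ <-].
  by rewrite lee_fin ler_pdivrMr// mulrC lerBlDr.
have C0e : (0 <= C%:E)%E by rewrite lee_fin ltW.
apply: le_trans (leeD (lee_wpmul2l C0e lb) (lexx B'%:E)).
by rewrite -EFinM -EFinD lee_fin mulrC divfK ?subrK// gt_eqF.
Qed.
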